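(* Let $f$ be a function from some family $\mathcal F$ to a free abelian group $U$ such that, for $(G,B)\in\mathcal F$, $$f(G,B)=\sum_{Q}\sum_{b}h(N_G(Q),b),$$ where the first sum runs over a set of representatives of $G$-orbits (under conjugation) of radical $p$-subgroups $Q$ of $G$, the second sum runs over all blocks $b$ of $kN_G(Q)$ such that $b^G=B$, and the function $h$ is an isomorphism-constant function on $\mathcal F$. Then $f$ is block chain local.
   Context: Let $p$ be a prime and $k$ an algebraically closed field of characteristic $p$; all groups are finite. A radical $p$-subgroup of a finite group $G$ is a $p$-subgroup $Q$ with $Q=O_p(N_G(Q))$, where $O_p$ denotes the largest normal $p$-subgroup. For a block $B$ of $kG$, $e_B\in Z(kG)$ is its block idempotent. For a subgroup $R$ of $G$, $\mathrm{Br}_R$ denotes the Brauer morphism at $R$ (truncation to $kC_G(R)$). Block induction: for a subgroup $H\le G$, a block $b$ of $kH$ corresponds to the block $B$ of $kG$, written $b^G=B$, if $\mathrm{Br}_H(e_B)e_b=e_b$, in other words if the block idempotent of $b$ is a summand of the restriction of the block idempotent of $B$ to the centraliser of $H$ in $G$. If such a $B$ exists, $b^G$ is said to be defined. A family $\mathcal F$ is a collection of pairs $(G,B)$, with $G$ a finite group of order divisible by $p$ and $B$ a block of $kG$, such that if $(G,B)\in\mathcal F$ then so are all pairs $(H,b)$ with $H\le G$ and $b^G=B$. Functions on $\mathcal F$ take values in a free abelian group. A function $f$ on $\mathcal F$ is isomorphism-constant if $f(G,B)=f(H,B')$ whenever $(G,B),(H,B')\in\mathcal F$ and there is an isomorphism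 $\phi:G\to H$ with $\phi(B)=B'$. A chain $C$ in $G$ is a set of $p$-subgroups $Q_0<Q_1<\cdots<Q_n$ of $G$ with $Q_0=\{1\}$ ($n\ge 0$); its length is $|C|=n$, and its stabiliser is $G_C=\bigcap_i N_G(Q_i)$. Put $B_C=\mathrm{Br}_{Q_n}(e_B)\,kG_C$, which is either zero or a sum of blocks of $kG_C$; $b\mid B_C$ means that the block $b$ of $kG_C$ is a summand of $B_C$. An isomorphism-constant function $f$ on $\mathcal F$ is block chain local if for all $(G,B)\in\mathcal F$, $$\sum_{C\in\mathcal R}(-1)^{|C|}\sum_{b\mid B_C}f(G_C,b)=0,$$ where $\mathcal R$ is a set of representatives of the $G$-orbits (under conjugation) of chains of $p$-subgroups of $G$.
   Formalization: The first sum runs over nontrivial radical p-subgroups only (with Q=1 the claim fails, e.g. S_3, p=2, h=1), and b^G=B is defined by Br_P(e_B)e_b=e_b for a p-subgroup P with P C_G(P) ≤ H ≤ N_G(P), since Br_H for arbitrary H is not a Brauer morphism. *)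

(* Defs.v *)
From HB Require Import structures.
From mathcomp Require Import all_boot all_order all_algebra all_fingroup.
From mathcomp Require Import all_solvable all_classical.
From mathcomp.multinomials Require Import freeg.

Set Implicit Arguments.
Unset Strict Implicit.
Unset Printing Implicit Defensive.
Import GroupScope GRing.Theory.
Local Open Scope ring_scope.

(* The group algebra of the ambient finite group gT: functions gT -> k under
   convolution.  For G : {group gT}, the algebra kG is the subalgebra in_galg G
   of the functions supported on G, so that kH lies inside kG when H <= G and
   restrictions between subgroups need no change of type. *)
Definition galg (k : fieldType) (gT : finGroupType) : Type := {ffun gT -> k^o}.

Section GroupAlgebraRing.
Variables (k : fieldType) (gT : finGroupType).
Implicit Types a b c : galg k gT.

HB.instance Definition _ := GRing.Lmodule.copy (galg k gT) {ffun gT -> k^o}.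

Definition galg_one : galg k gT := [ffun x => ((x == 1%g)%:R : k)].
Definition galg_mul a b : galg k gT :=
  [ffun x => \sum_(y : gT) (a y : k) * b (y^-1 * x)%g].

Fact galg_mulA : associative galg_mul.
Proof.
move=> a b c; apply/ffunP=> x; rewrite !ffunE.
under eq_bigr do rewrite ffunE mulr_sumr.
under [RHS]eq_bigr do rewrite ffunE mulr_suml.
rewrite [RHS]exchange_big /=; apply: eq_bigr => y _.
rewrite [RHS](reindex_inj (mulgI y)) /=; apply: eq_bigr => z _.
by rewrite mulKg invMg mulgA mulrA.
Qed.

Fact galg_mul1l : left_id galg_one galg_mul.
Proof.
move=> a; apply/ffunP=> x; rewrite ffunE (bigD1 1%g) //= ffunE eqxx mul1r.
rewrite invg1 mul1g big1 ?addr0 // => y /negPf y1.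
by rewrite ffunE y1 mul0r.
Qed.

Fact galg_mul1r : right_id galg_one galg_mul.
Proof.
move=> a; apply/ffunP=> x; rewrite ffunE (bigD1 x) //= ffunE mulVg eqxx mulr1.
rewrite big1 ?addr0 // => y yx; rewrite ffunE.
by rewrite -(inj_eq (mulgI y)) mulKVg mulg1 eq_sym (negPf yx) mulr0.
Qed.

Fact galg_mulDl : left_distributive galg_mul +%R.
Proof.
move=> a b c; apply/ffunP=> x; rewrite !ffunE -big_split /=.
by apply: eq_bigr => y _; rewrite ffunE mulrDl.
Qed.

Fact galg_mulDr : right_distributive galg_mul +%R.
Proof.
move=> a b c; apply/ffunP=> x; rewrite !ffunE -big_split /=.
by apply: eq_bigr => y _; rewrite ffunE mulrDr.
Qed.

Fact galg_one_neq0 : galg_one != 0.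
Proof.
by apply/eqP=> /ffunP/(_ 1%g)/eqP; rewrite !ffunE eqxx (negPf (oner_neq0 _)).
Qed.

HB.instance Definition _ := GRing.Zmodule_isNzRing.Build (galg k gT)
  galg_mulA galg_mul1l galg_mul1r galg_mulDl galg_mulDr galg_one_neq0.

Fact galg_scaleAl (l : k) a b : l *: (a * b) = (l *: a) * b.
Proof.
apply/ffunP=> x; rewrite !ffunE scaler_sumr; apply: eq_bigr => y _.
by rewrite ffunE scalerAl.
Qed.

HB.instance Definition _ :=
  GRing.Lmodule_isLalgebra.Build k (galg k gT) galg_scaleAl.

Fact galg_scaleAr (l : k) a b : l *: (a * b) = a * (l *: b).
Proof.
apply/ffunP=> x; rewrite !ffunE scaler_sumr; apply: eq_bigr => y _.
by rewrite ffunE [in RHS]mulrCA.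
Qed.

HB.instance Definition _ :=
  GRing.Lalgebra_isAlgebra.Build k (galg k gT) galg_scaleAr.

End GroupAlgebraRing.

Section Blocks.
Variables (k : fieldType) (gT : finGroupType).
Implicit Types (G H P Q : {group gT}) (a b c e : galg k gT).

Definition in_galg G a : Prop := forall x, x \notin G -> a x = 0.

Definition central_idem G e : Prop :=
  [/\ in_galg G e, forall a, in_galg G a -> e * a = a * e & e * e = e].

(* A block B of kG is represented throughout by its block idempotent e_B, a
   primitive idempotent of Z(kG). *)
Definition is_block G b : Prop :=
  [/\ central_idem G b, b != 0
    & forall e, central_idem G e -> e * b = e -> e = 0 \/ e = b].

Definition Br G P a : galg k gT := [ffun x => if x \in 'C_G(P) then a x else 0].

(* b^G = B.  The Brauer morphism has to be taken at a p-subgroup, namely a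
   p-subgroup P with P C_G(P) <= H <= N_G(P), so that Br_P(e_B) is a central
   idempotent of kH; which P is used does not matter. *)
Definition block_induces (p : nat) G B H b : Prop :=
  [/\ is_block G B, is_block H b
    & exists P, [/\ p.-group P, (P * 'C_G(P))%g \subset H, H \subset 'N_G(P)
                  & Br G P B * b = b]].

(* Note that 1 is radical in G exactly when O_p(G) = 1. *)
Definition radical (p : nat) G Q : bool :=
  [&& Q \subset G, p.-group Q & Q :==: 'O_p('N_G(Q))].

(* A chain is represented by its set of terms, the trivial subgroup included. *)
Definition is_chain (p : nat) G (C : {set {group gT}}) : bool :=
  [&& 1%G \in C,
      [forall Q in C, (Q \subset G) && p.-group Q]
    & [forall Q in C, forall P in C, (Q \subset P) || (P \subset Q)]].

Definition chain_len (C : {set {group gT}}) : nat := #|C|.-1.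

Definition chain_top (C : {set {group gT}}) : {group gT} :=
  [arg max_(Q > 1%G in C) #|Q|].

Definition chain_stab G (C : {set {group gT}}) : {group gT} :=
  (\bigcap_(Q in C) 'N_G(Q))%G.

(* The blocks b of kG_C with b | B_C, where B_C = Br_{Q_n}(e_B) kG_C. *)
Definition chain_blocks G B (C : {set {group gT}}) : set (galg k gT) :=
  [set b | is_block (chain_stab G C) b /\ Br G (chain_top C) B * b = b]%classic.

(* T is a set of representatives of the G-orbits of radical p-subgroups. *)
Definition radical_reps (p : nat) G (T : {set {group gT}}) : bool :=
  let S := [set Q | radical p G Q] in
  is_transversal T (orbit 'JG%act G @: S) S.

(* R is a set of representatives of the G-orbits of chains of p-subgroups. *)
Definition chain_reps (p : nat) G (R : {set {set {group gT}}}) : bool :=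
  let S := [set C | is_chain p G C] in
  is_transversal R (orbit ('JG^*)%act G @: S) S.

(* The sums over blocks are \sum_(b \in _), which requires finiteness. *)
Lemma finite_blocks G : finite_set [set b | is_block G b]%classic.
Proof.
have orth b c : is_block G b -> is_block G c -> b != c -> b * c = 0.
  move=> [[Gb Zb Ib] nzb prb] [[Gc Zc Ic] nzc prc] nbc.
  have bcC : b * c = c * b by apply: Zb.
  have Gbc : central_idem G (b * c).
    split.
    - move=> x xG; rewrite ffunE big1 // => y _.
      have [yG|yG] := boolP (y \in G); last by rewrite Gb // mul0r.
      by rewrite Gc ?mulr0 // groupMl ?groupV.
    - by move=> a Ga; rewrite -mulrA Zc // mulrA Zb // mulrA.
    - by rewrite -mulrA (mulrA c) -bcC -mulrA Ic mulrA Ib.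
  case: (prb _ Gbc); rewrite ?bcC -?mulrA ?Ib // -bcC => bcb.
  case: (prc _ Gbc); rewrite -?mulrA ?Ic // bcb => bc.
  by rewrite -bc -bcb bcC eqxx in nbc.
apply: contrapT => inf.
pose n := (dim {ffun gT -> k^o}).+1.
have [D sDA szD] := infinite_set_fset n inf.
pose X := finmap.enum_fset D : seq (galg k gT).
pose Y := in_tuple (X : seq {ffun gT -> k^o}).
suff: free Y.
  rewrite /free => /eqP eqd; have := dimvS (subvf (span Y)).
  rewrite eqd dimvf; apply/negP; rewrite -ltnNge. exact: szD.
apply/freeP => l sum0 i.
have blk (j : 'I_(size X)) : is_block G X`_j.
  by apply: sDA; rewrite /= mem_nth.
have : \sum_(j < size X) l j *: (X`_j : galg k gT) = 0 by exact: sum0.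
move=> /(congr1 (fun a => a * X`_i)); rewrite mul0r mulr_suml (bigD1 i) //=.
rewrite big1 ?addr0 => [|j ji]; last first.
  rewrite -scalerAl orth ?scaler0 //.
  by rewrite nth_uniq ?finmap.fset_uniq //.
have [[_ _ idi] nz _] := blk i.
by rewrite -scalerAl idi => /eqP; rewrite scaler_eq0 (negPf nz) orbF => /eqP.
Qed.

End Blocks.

Section Families.
Variables (k : fieldType) (U : zmodType) (p : nat).

(* A function on a family F is given by a total function; iso_constant only
   looks at its values on F, and so does block_chain_local, because (G_C, b)
   lies in F whenever (G, B) does and b | B_C. *)
Definition pairs : Type :=
  forall gT : finGroupType, {group gT} -> galg k gT -> Prop.
Definition pairfun : Type :=
  forall gT : finGroupType, {group gT} -> galg k gT -> U.

Definition is_family (F : pairs) : Prop :=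
  forall (gT : finGroupType) (G : {group gT}) (B : galg k gT), F gT G B ->
  [/\ (p %| #|G|)%N, is_block G B
    & forall (H : {group gT}) (b : galg k gT),
        H \subset G -> block_induces p G B H b -> F gT H b].

(* The k-linear extension kG -> kH of a group morphism phi on G. *)
Definition galg_map (gT rT : finGroupType) (G : {group gT})
    (phi : {morphism G >-> rT}) (a : galg k gT) : galg k rT :=
  [ffun y => \sum_(x in G | phi x == y) a x].

Definition iso_constant (F : pairs) (f : pairfun) : Prop :=
  forall (gT rT : finGroupType) (G : {group gT}) (H : {group rT})
    (B : galg k gT) (B' : galg k rT) (phi : {morphism G >-> rT}),
  F gT G B -> F rT H B' -> isom G H phi -> galg_map phi B = B' ->
  f gT G B = f rT H B'.

Definition block_chain_local (F : pairs) (f : pairfun) : Prop :=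
  iso_constant F f /\
  forall (gT : finGroupType) (G : {group gT}) (B : galg k gT), F gT G B ->
  forall R : {set {set {group gT}}}, chain_reps p G R ->
  \sum_(C in R) (\sum_(b \in chain_blocks G B C) f gT (chain_stab G C) b)
     *~ ((-1) ^+ chain_len C) = 0.

End Families.

Definition free_abelian (U : zmodType) : Prop :=
  exists (K : choiceType) (phi : {additive U -> {freeg K}}),
    bijective phi.

(* Main.v *)
(* After multiplication by [#|G|], the sum over representatives of orbits of
   chains becomes a sum over all chains weighted by the orders of their
   stabilisers [G_C], and likewise for the sum defining [f]; nothing is lost
   because [U] is torsion free.

   A chain is normal when [G_C] contains its terms.  The other chains cancel in
   pairs: if [M] is the least term not normalising all the smaller ones, and
   [D] consists of the elements of [M] that do, then inserting or removing [D]
   changes neither [M], [D], [G_C] nor the top of the chain.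

   For a normal chain [C], a radical subgroup [Q] of [G_C] contains [O_p(G_C)],
   hence the top of [C], and inserting or removing [Q] preserves ['N_(G_C)(Q)].
   The blocks [b'] of ['N_(G_C)(Q)] occurring at [(C, Q)] are those with
   [Br_Q(e_B) b' = b'], so that the pairs [(C, Q)] cancel as well.  This uses
   that block induction does not depend on the subgroup at which the Brauer
   morphism is taken: a central idempotent of [kH] is supported on ['C_H(P)]
   for every normal [p]-subgroup [P] of [H]. *)

Require Import Defs.
From HB Require Import structures.
From mathcomp Require Import all_boot all_order all_algebra all_fingroup.
From mathcomp Require Import all_solvable all_classical.
From mathcomp.multinomials Require Import freeg.

Set Implicit Arguments.
Unset Strict Implicit.
Unset Printing Implicit Defensive.
Import GroupScope GRing.Theory.
Local Open Scope ring_scope.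

(** * Torsion-freeness, and sums over orbits, fixed points and fibres *)

Section OrbitSums.
Import mathcomp.boot.fintype mathcomp.boot.finset.

Lemma free_abelian_torsion_free (U : zmodType) :
  free_abelian U -> forall (u : U) n, (0 < n)%N -> u *+ n = 0 -> u = 0.
Proof.
case=> K [phi bij_phi] u n n_gt0 un0.
apply: (bij_inj bij_phi); rewrite raddf0.
have phin0 : phi u *+ n = 0 by rewrite -raddfMn un0 raddf0.
apply/eqP/freeg_eqP => x; apply/eqP; rewrite raddf0.
have := congr1 (coeff x) phin0; rewrite raddfMn raddf0 /= => /eqP.
by rewrite -mulr_natr mulf_eq0 Num.Theory.pnatr_eq0 eqn0Ngt n_gt0 orbF.
Qed.

Lemma mulrn_inj (U : zmodType) (freeU : free_abelian U) n :
  (0 < n)%N -> injective (fun u : U => u *+ n).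
Proof.
move=> n_gt0 u v /= uv; apply/eqP; rewrite -subr_eq0; apply/eqP.
by apply: (free_abelian_torsion_free freeU n_gt0); rewrite mulrnBl uv subrr.
Qed.

(** [#|G|] is the length of an orbit times the order of a stabiliser, so [#|G|] copies of the term
    at a representative spread evenly over its orbit. Used both for radical subgroups and for
    chains. *)
Lemma sum_transversal (aT : finGroupType) (T : finType) (to : {action aT &-> T})
    (V : zmodType) (G : {group aT}) (S X : {set T}) (phi : T -> V) :
    [acts G, on S | to] -> is_transversal X (orbit to G @: S) S ->
    (forall x a, x \in S -> a \in G -> phi (to x a) = phi x) ->
  (\sum_(x in X) phi x) *+ #|G| = \sum_(x in S) phi x *+ #|'C_G[x | to]|.
Proof.
move=> actS trX phiJ; have parS := orbit_partition actS.
have [_ tiP _] := and3P parS.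
have sXS := transversal_sub trX.
rewrite -sumrMnl.
rewrite (set_partition_big _ parS) /= -{1}(pblock_transversal trX).
rewrite big_imset /=; last exact: (pblock_inj trX).
apply: eq_bigr => x Xx; have Sx := subsetP sXS x Xx.
rewrite (def_pblock (B := orbit to G x) tiP) ?orbit_refl ?imset_f //.
rewrite (eq_bigr (fun=> phi x *+ #|'C_G[x | to]|)) => [|_ /orbitP[a Ga <-]].
  by rewrite sumr_const -mulrnA mulnC card_orbit_in_stab ?subsetT.
rewrite phiJ //; congr (_ *+ _).
have orb_gt0 : (0 < #|orbit to G x|)%N.
  by rewrite card_gt0; apply/set0Pn; exists x; apply: orbit_refl.
apply/eqP; rewrite -(eqn_pmul2l orb_gt0) card_orbit_in_stab ?subsetT //.
by rewrite -(orbit_act to x Ga) card_orbit_in_stab ?subsetT.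
Qed.

(** A non-trivial orbit has length a positive power of [p], so its equal terms add up to 0 in
    characteristic [p]. *)
Lemma sum_pgroup_fixed (aT : finGroupType) (T : finType)
    (to : {action aT &-> T}) (R : nzRingType) (p : nat) (P : {group aT})
    (phi : T -> R) :
    p \in [pchar R] -> p.-group P ->
    (forall x a, a \in P -> phi (to x a) = phi x) ->
  \sum_x phi x = \sum_(x in 'Fix_to(P)) phi x.
Proof.
move=> charR pP phiJ.
have acts : [acts P, on ~: 'Fix_to(P) | to].
  apply/actsP=> a Pa x; rewrite !in_setC.
  by rewrite (actsP (acts_fix_norm to (normG P)) a Pa).
have parF := orbit_partition acts.
rewrite (bigID (mem 'Fix_to(P))) /= [X in _ + X]big_mkcond /=.
rewrite [X in _ + X](_ : _ = 0) ?addr0 // -big_mkcond /=.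
rewrite (eq_bigl (mem (~: 'Fix_to(P)))) => [|x]; last by rewrite !inE.
rewrite (set_partition_big _ parF) /= big1 // => _ /imsetP[x nFx ->].
rewrite (eq_bigr (fun=> phi x)) => [|_ /orbitP[a Pa <-]]; last exact: phiJ.
have [n card_orb] := p_natP (pnat_dvd (dvdn_orbit to P x) pP).
rewrite sumr_const card_orb; case: n card_orb => [/card_orbit1 orb1 | n _].
  move: nFx; rewrite inE => /afixP[] a Pa.
  by apply/set1P; rewrite -orb1 mem_orbit.
by rewrite -mulr_natr expnS natrM (pcharf0 charR) mul0r mulr0.
Qed.

(** The sets [Y i], for [i] in [A], are disjoint and cover [X]. In the application [i] is a block of
    a chain stabiliser, and [Y i] consists of the blocks inducing to it from the normaliser of a
    radical subgroup. *)
Lemma fsbig_fibers (U : zmodType) (I J : choiceType) (A : set I)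
    (X : set J) (Y : I -> set J) (phi : J -> U) :
    finite_set A -> finite_set X ->
    (forall i j, A i -> Y i j -> X j) ->
    (forall j, X j -> exists2 i, A i & Y i j) ->
    (forall i1 i2 j, Y i1 j -> Y i2 j -> i1 = i2) ->
  \sum_(i \in A) \sum_(j \in Y i) phi j = \sum_(j \in X) phi j.
Proof.
move=> finA finX YX Xex Yinj.
transitivity (\sum_(i \in A) \sum_(j \in X) if j \in Y i then phi j else 0).
  apply: eq_fsbigr => i /set_mem Ai; rewrite -fsbig_mkcondr.
  by apply: eq_fsbigl; apply/esym/setIidr => j; apply: YX.
rewrite exchange_fsbig //; apply: eq_fsbigr => j /set_mem /Xex[i0 Ai0 Yj].
rewrite (eq_fsbigr (fun i => if i \in [set i | Y i j]%classic then phi j else 0)).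
  rewrite -fsbig_mkcondr (_ : _ `&` _ = [set i0])%classic ?fsbig_set1 //.
   apply/seteqP; split=> [i [_ /Yinj/(_ Yj)] // | _ -> //].
by move=> i _; congr (if _ then _ else _); apply/idP/idP => /set_mem Yij; apply/mem_set.
Qed.

End OrbitSums.

(** * Group algebras and the Brauer morphism *)

Section GroupAlgebra.
Import mathcomp.boot.fintype mathcomp.boot.finset.
Variables (k : fieldType) (gT : finGroupType).
Implicit Types (G H K P Q : {group gT}) (a b e : galg k gT).

(** The group element [x] as a basis vector of the group algebra. *)
Definition gdelta (x : gT) : galg k gT := [ffun y => (y == x)%:R].

Lemma galg_mulE a b x : (a * b) x = \sum_y (a y : k) * b (y^-1 * x)%g.
Proof. by rewrite ffunE. Qed.

Lemma gdelta_mull x a y : (gdelta x * a) y = a (x^-1 * y)%g.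
Proof.
rewrite galg_mulE (bigD1 x) //= ffunE eqxx mul1r big1 ?addr0 // => z /negPf zx.
by rewrite ffunE zx mul0r.
Qed.

Lemma gdelta_mulr x a y : (a * gdelta x) y = a (y * x^-1)%g.
Proof.
rewrite galg_mulE (bigD1 (y * x^-1)%g) //= ffunE invMg invgK mulgKV eqxx mulr1.
rewrite big1 ?addr0 // => z zyx; rewrite ffunE.
by case: eqP => [zx|]; rewrite ?mulr0 //; case/eqP: zyx; rewrite -zx invMg invgK mulKVg.
Qed.

Lemma gdelta1 : gdelta 1 = 1. Proof. by []. Qed.

Lemma gdeltaM x y : gdelta (x * y) = gdelta x * gdelta y.
Proof.
by apply/ffunP=> z; rewrite gdelta_mull !ffunE -[in RHS](inj_eq (mulgI x)) mulKVg.
Qed.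

Lemma gdeltaX x n : gdelta (x ^+ n) = gdelta x ^+ n.
Proof. by elim: n => // n IHn; rewrite expgS gdeltaM IHn exprS. Qed.

Lemma in_gdelta G x : x \in G -> in_galg G (gdelta x).
Proof. by move=> Gx y; rewrite ffunE; case: eqP => // ->; rewrite Gx. Qed.

Lemma in_galgB G a b : in_galg G a -> in_galg G b -> in_galg G (a - b).
Proof. by move=> Ga Gb x xG; rewrite !ffunE Ga ?Gb ?subrr. Qed.

Lemma in_galgM G a b : in_galg G a -> in_galg G b -> in_galg G (a * b).
Proof.
move=> Ga Gb x xG; rewrite ffunE big1 // => y _.
have [yG|yG] := boolP (y \in G); last by rewrite Ga // mul0r.
by rewrite Gb ?mulr0 // groupMl ?groupV.
Qed.

Lemma in_galgX G a n : in_galg G a -> in_galg G (a ^+ n).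
Proof.
move=> Ga; elim: n => [|n IHn]; first by rewrite expr0 -gdelta1; apply: in_gdelta.
by rewrite exprS; apply: in_galgM.
Qed.

Lemma in_galgS G H a : G \subset H -> in_galg G a -> in_galg H a.
Proof. by move=> sGH Ga x xH; apply: Ga; apply: contra xH => /(subsetP sGH). Qed.

Lemma central_conj G e x y :
  central_idem G e -> x \in G -> e (y ^ x)%g = e y.
Proof.
case=> Ge Ze _ Gx; have /ffunP/(_ (y * x)%g) := Ze _ (in_gdelta Gx).
by rewrite gdelta_mull gdelta_mulr mulgK -conjgE.
Qed.

Lemma conj_central G a b :
    (forall x y, x \in G -> a (y ^ x)%g = a y) -> in_galg G b ->
  a * b = b * a.
Proof.
move=> aJ Gb; apply/ffunP=> x; rewrite !galg_mulE.
(* Once [y] is replaced by [x * y^-1], the arguments of [a] on the two sides are conjugate under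
   [y], which lies in [G] whenever [b y] is non-zero. *)
rewrite (reindex_inj (inj_comp (mulgI x) invg_inj)) /=.
apply: eq_bigr => y _; rewrite invMg invgK mulgKV mulrC.
have [Gy|/Gb->] := boolP (y \in G); last by rewrite !mul0r.
by rewrite -(aJ y) // conjgE mulgKV.
Qed.

Lemma BrB G P a b : Br G P (a - b) = Br G P a - Br G P b.
Proof. by apply/ffunP=> x; rewrite !ffunE; case: ifP; rewrite ?subrr. Qed.

Lemma Br_Br G K P Q a :
    'C_G(Q) \subset K -> K \subset G -> P \subset Q ->
  Br K Q (Br G P a) = Br G Q a.
Proof.
move=> sCK sKG sPQ; apply/ffunP=> x; rewrite !ffunE.
have -> : (x \in 'C_K(Q)) = (x \in 'C_G(Q)).
  apply/setIP/setIP=> -[xA xC]; split=> //; first exact: (subsetP sKG).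
  by apply: (subsetP sCK); rewrite inE xA.
by case: ifP => // xC; rewrite (subsetP (setIS G (centS sPQ))).
Qed.

Section Modular.
Variable p : nat.
Hypothesis charkp : p \in [pchar k].

(** At an [x] centralising [P], the terms [a y * b (y^-1 * x)] of the convolution are constant on
    the [P]-classes of [y]. By [sum_pgroup_fixed] only the [y] centralising [P] contribute. *)
Lemma Br_mul G P a b :
    p.-group P -> in_galg G a ->
    (forall x y, x \in P -> a (y ^ x)%g = a y) ->
    (forall x y, x \in P -> b (y ^ x)%g = b y) ->
  Br G P (a * b) = Br G P a * Br G P b.
Proof.
move=> pP Ga aJ bJ; apply/ffunP=> x; rewrite [in LHS]ffunE !galg_mulE.
case: ifPn => [/setIP[Gx Cx] | nCx]; last first.
  rewrite big1 // => y _; rewrite !ffunE.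
  have [yC|_] := ifPn; last by rewrite mul0r.
  case: ifPn => [yxC|_]; rewrite ?mulr0 //; case/negP: nCx.
  by rewrite -(mulKVg y x) groupM.
rewrite (sum_pgroup_fixed (to := 'J%act) charkp pP) => [|y z Pz] /=; last first.
  have xz : (x ^ z)%g = x by apply/conjg_fixP/commgP/(centP Cx).
  by rewrite aJ // -[in RHS](bJ z) // conjMg conjVg xz.
rewrite [RHS](bigID (mem 'C(P))) /= [X in _ = _ + X]big1 ?addr0 => [|y nCy].
  rewrite afixJ; apply: eq_bigr => y Cy; rewrite !ffunE !inE Cy andbT.
  have [Gy|/Ga->] := boolP (y \in G); last by rewrite !mul0r.
  by rewrite groupMl ?groupV // Gx groupM ?groupV.
by rewrite ffunE inE (negPf nCy) andbF mul0r.
Qed.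

(** Since [K] normalises [P], it acts by conjugation on ['C_G(P)], so the truncation of [e] is still
    invariant under [K]. Idempotence comes from [Br_mul]. *)
Lemma Br_central_idem G K P e :
    p.-group P -> P \subset G -> K \subset G ->
    'C_G(P) \subset K -> K \subset 'N(P) ->
  central_idem G e -> central_idem K (Br G P e).
Proof.
move=> pP sPG sKG sCK nPK idemE; have [Ge _ Ie] := idemE.
have eJ x y : x \in P -> e (y ^ x)%g = e y.
  by move=> /(subsetP sPG)/(central_conj y idemE).
split; last by rewrite -Br_mul // Ie.
  by move=> x nKx; rewrite ffunE ifN //; apply: contra nKx => /(subsetP sCK).
move=> a; apply: conj_central => x y Kx; rewrite !ffunE.
rewrite (central_conj y idemE) ?(subsetP sKG) // memJ_norm //.
apply: subsetP Kx; apply: normsI; first exact: subset_trans sKG (normG G).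
exact: subset_trans nPK (cent_norm _).
Qed.

End Modular.
End GroupAlgebra.

(** * Central idempotents and normal [p]-subgroups *)

Section CentralIdempotents.
Import mathcomp.boot.fintype mathcomp.boot.finset.
Variables (k : fieldType) (gT : finGroupType).
Implicit Types (G H K P Q : {group gT}) (a b e : galg k gT).
Variable p : nat.
Hypothesis charkp : p \in [pchar k].

Lemma exprBpX_comm (R : nzRingType) (x y : R) n :
  p \in [pchar R] -> GRing.comm x y -> (x - y) ^+ (p ^ n) = x ^+ (p ^ n) - y ^+ (p ^ n).
Proof.
move=> charR cxy; elim: n => [|n IHn]; first by rewrite !expr1.
rewrite expnSr !exprM IHn -!(pFrobenius_autE charR) pFrobenius_autB_comm //.
by apply: commrX; apply/commr_sym/commrX/commr_sym.
Qed.

Lemma pchar_galg : p \in [pchar (galg k gT)].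
Proof. by rewrite pchar_lalg. Qed.

(* If a vector is fixed by a normal subgroup [M] of [P], so are its images
   under the powers of [gdelta x - 1] for [x] in [P].  The last non-zero image,
   which exists as [(gdelta x - 1) ^+ #|P| = gdelta (x ^+ #|P|) - 1 = 0], is also
   fixed by [x]. *)
Lemma pgroup_fixed_vector P a :
    p.-group P -> a != 0 ->
  exists c, [/\ in_galg P c, c * a != 0
              & forall x, x \in P -> gdelta k x * (c * a) = c * a].
Proof.
have [n] := ubnP #|P|; elim: n P => // n IHn P leP pP a0.
have [->|ntP] := eqVneq P 1%G.
  exists 1; split; rewrite ?mul1r //; first by rewrite -gdelta1; apply: in_gdelta.
  by move=> x /set1P->; rewrite gdelta1 mul1r.
have [/esym P1 | [M maxM _]] := maximal_exists (sub1G P).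
  by case/eqP: ntP; apply: group_inj.
have /andP[sMP nMP] := p_maximal_normal pP maxM.
have [_ [x Px nMx]] := properP (maxgroupp maxM).
have [|c0 [Mc0 c0a c0fix]] := IHn M _ (pgroupS sMP pP) a0.
  by apply: leq_trans (proper_card (maxgroupp maxM)) _.
pose d := gdelta k x - 1.
have dPn0 : d ^+ #|P| = 0.
  have [m oP] := p_natP pP.
  rewrite oP exprBpX_comm ?pchar_galg //; last exact: commr1.
  by rewrite -gdeltaX -oP expg_cardG // gdelta1 expr1n subrr.
have exj : exists j, d ^+ j * (c0 * a) == 0 by exists #|P|; rewrite dPn0 mul0r.
case: (ex_minnP exj) => -[|j]; first by rewrite expr0 mul1r (negPf c0a).
rewrite exprS -mulrA => /eqP dv0 minj; pose v := d ^+ j * (c0 * a).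
(* As [m * x = x * m ^ x] with [m ^ x] in [M], multiplication by [d] sends vectors fixed by [M] to
   vectors fixed by [M]. *)
have Mv m i : m \in M -> gdelta k m * (d ^+ i * (c0 * a)) = d ^+ i * (c0 * a).
  elim: i m => [|i IHi] m Mm; first by rewrite expr0 mul1r c0fix.
  rewrite exprS -mulrA {1 3}/d mulrBl mul1r mulrBr mulrA -gdeltaM conjgC gdeltaM.
  by rewrite -mulrA (IHi m) ?(IHi (m ^ x)%g) // memJ_norm // (subsetP nMP).
have xv i : gdelta k (x ^+ i) * v = v.
  elim: i => [|i IHi]; first by rewrite gdelta1 mul1r.
  rewrite expgSr gdeltaM -mulrA -{2}IHi; congr (_ * _).
  by apply/eqP; rewrite -subr_eq0 -{2}[v]mul1r -mulrBl dv0.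
exists (d ^+ j * c0); split; rewrite -?mulrA.
- apply: in_galgM; last exact: in_galgS Mc0.
  apply: in_galgX; apply: in_galgB; first exact: in_gdelta.
  by rewrite -gdelta1; apply: in_gdelta.
- by apply/negP=> /minj; rewrite ltnn.
have defP : (M * <[x]>)%g = P.
  by apply: mulg_normal_maximal (p_maximal_normal pP maxM) maxM _ _; rewrite cycle_subG.
move=> y; rewrite -defP.
by case/mulsgP=> m _ Mm /cycleP[i ->] ->; rewrite gdeltaM -mulrA xv Mv.
Qed.

(* The difference [d] of the two sides lies in the ideal of [kH] generated by
   the augmentation ideal of [kP]; hence it annihilates every vector fixed by
   [P].  Since [d ^+ p = d], it would otherwise act faithfully on such a
   vector. *)
Lemma Br_normal H P e :
    p.-group P -> P \subset H -> H \subset 'N(P) -> central_idem H e ->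
  Br H P e = e.
Proof.
move=> pP sPH nPH idemE; have [He Ze Ie] := idemE.
have idemF : central_idem H (Br H P e).
  by apply: (Br_central_idem charkp) => //; apply: subsetIl.
have [Hf Zf If] := idemF; pose d := e - Br H P e.
have Hd : in_galg H d by apply: in_galgB.
have Zd a : in_galg H a -> d * a = a * d.
  by move=> Ha; rewrite mulrBl mulrBr Ze ?Zf.
have p_gt1 : (1 < p)%N := prime_gt1 (pcharf_prime charkp).
have idemX (a : galg k gT) n : a * a = a -> a ^+ n.+1 = a.
  by move=> Ia; elim: n => // n IHn; rewrite exprS IHn.
(* [e] and [Br H P e] are commuting idempotents, and the [p]-th power map is additive on them. *)
have dX : d ^+ p = d.
  rewrite -{1}[p]expn1 exprBpX_comm ?pchar_galg //; last exact: Ze.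
  by rewrite expn1 -(prednK (ltnW p_gt1)) !idemX.
suff d0 : d = 0 by apply/esym/eqP; rewrite -subr_eq0; apply/eqP.
apply/eqP/negPn/negP => nzd.
have [c [Pc nzv vfix]] := pgroup_fixed_vector pP nzd.
(* Replacing [y] by [y ^ z] multiplies the argument of the fixed vector [c * d] by an element of
   [P], because [[~ y, z]] lies in [P]; and [d] is invariant under [P]. So only the [y] centralising
   [P] count in the convolution, and [d] vanishes there. *)
have dv0 : d * (c * d) = 0.
  apply/ffunP=> x; rewrite galg_mulE [RHS]ffunE.
  rewrite (sum_pgroup_fixed (to := 'J%act) charkp pP) => [|y z Pz] /=.
    rewrite afixJ big1 // => y Cy; rewrite !ffunE !inE Cy andbT.
    by case: ifPn => [|/He->]; rewrite subrr mul0r.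
  have [Hy | nHy] := boolP (y \in H); last first.
    by rewrite !Hd ?mul0r // memJ_norm // (subsetP (normG H)) // (subsetP sPH).
  have dJ : d (y ^ z)%g = d y.
    rewrite !ffunE !(central_conj _ idemE) ?(subsetP sPH) // memJ_norm //.
    apply: subsetP Pz; apply: normsI; last exact: subset_trans (normG P) (cent_norm P).
    exact: subset_trans sPH (normG H).
  rewrite dJ; congr (_ * _).
  have Pw : [~ y, z] \in P.
    by rewrite commgEr groupM // memJ_norm ?groupV // (subsetP nPH).
  have /ffunP/(_ (y^-1 * x)%g) := vfix _ Pw; rewrite gdelta_mull => <-.
  by rewrite mulgA -invMg commgEl mulKVg.
case/eqP: nzv.
have Hc := in_galgS sPH Pc.
(* [c * d = c * d ^+ p = d * (c * d) * d ^+ (p - 2)], and the first two factors give 0. *)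
rewrite -dX -(subnK p_gt1) addn2 !exprS !mulrA -(Zd c) //.
by rewrite -(mulrA d) dv0 mul0r.
Qed.

(** Both sides are compared with the truncation at [P <*> Q], again a normal [p]-subgroup of [H].
    Truncating [Br G P e] further, at a larger normal [p]-subgroup of [H], changes nothing by
    [Br_normal], since [Br G P e] is a central idempotent of [kH]. *)
Lemma Br_indep G H P Q e :
    p.-group P -> (P * 'C_G(P))%g \subset H -> H \subset 'N_G(P) ->
    p.-group Q -> (Q * 'C_G(Q))%g \subset H -> H \subset 'N_G(Q) ->
  central_idem G e -> Br G P e = Br G Q e.
Proof.
have normal_sub P1 : (P1 * 'C_G(P1))%g \subset H -> H \subset 'N_G(P1) ->
    [/\ P1 \subset H, 'C_G(P1) \subset H, H \subset G & H \subset 'N(P1)].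
  move=> sH; rewrite subsetI => /andP[-> ->]; split=> //.
    exact: subset_trans (mulG_subl _ _) sH.
  exact: subset_trans (mulG_subr _ _) sH.
have step P1 Q1 : p.-group P1 -> (P1 * 'C_G(P1))%g \subset H ->
    H \subset 'N_G(P1) -> p.-group Q1 -> P1 \subset Q1 -> Q1 \subset H ->
    H \subset 'N(Q1) -> central_idem G e -> Br G Q1 e = Br G P1 e.
  move=> pP1 sP1H nP1H pQ1 sPQ sQH nQH idemE.
  have [sPH sCH sHG nPH] := normal_sub _ sP1H nP1H.
  rewrite -(Br_Br (K := H) _ _ _ sPQ) //; last first.
    by apply: subset_trans sCH; apply: setIS; apply: centS.
  apply: Br_normal => //; apply: (Br_central_idem charkp) => //.
  exact: subset_trans sPH sHG.
move=> pP sPH nPH pQ sQH nQH idemE.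
have [sP sCP sHG nP] := normal_sub _ sPH nPH.
have [sQ sCQ _ nQ] := normal_sub _ sQH nQH.
have pPQ : p.-group (P <*> Q)%G.
  by rewrite /= norm_joinEr ?(subset_trans sQ) // pgroupM pP.
have sPQH : (P <*> Q)%G \subset H by rewrite /= join_subG sP.
have nPQ : H \subset 'N(P <*> Q)%G by rewrite /= normsY.
by rewrite -(step P (P <*> Q)%G) ?(step Q (P <*> Q)%G) ?joing_subl ?joing_subr.
Qed.

Lemma block_orth H b c :
  is_block H b -> is_block H c -> b * c != 0 -> b = c.
Proof.
move=> [[Hb Zb Ib] nzb prb] [[Hc Zc Ic] nzc prc] nzbc.
have bcC : b * c = c * b by apply: Zb.
have idem_bc : central_idem H (b * c).
  split; first exact: in_galgM.
    by move=> a Ha; rewrite -mulrA Zc // mulrA Zb // mulrA.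
  by rewrite -mulrA (mulrA c) -bcC -mulrA Ic mulrA Ib.
case: (prb _ idem_bc) => [||<-]; first by rewrite bcC -mulrA Ib.
  by move/eqP; rewrite (negPf nzbc).
by case: (prc _ idem_bc) => [||-> //]; [rewrite -mulrA Ic | move/eqP; rewrite (negPf nzbc)].
Qed.

Lemma block_mul_idem H b e :
  is_block H b -> central_idem H e -> e * b = 0 \/ e * b = b.
Proof.
move=> [[Hb Zb Ib] nzb prb] [He Ze Ie]; apply: prb; last by rewrite -mulrA Ib.
split; first exact: in_galgM.
  by move=> a Ha; rewrite -mulrA Zb // mulrA Ze // mulrA.
by rewrite -mulrA (mulrA b) Zb // -mulrA Ib mulrA Ie.
Qed.

End CentralIdempotents.

(** * Block induction *)

HB.instance Definition _ (k : fieldType) (gT : finGroupType) :=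
  Vector.copy (galg k gT) {ffun gT -> k^o}.

Section BlockInduction.
Import mathcomp.boot.fintype mathcomp.boot.finset.
Variables (k : fieldType) (gT : finGroupType).
Implicit Types (G H K P Q : {group gT}) (a b c e f : galg k gT).
Variable p : nat.
Hypothesis charkp : p \in [pchar k].

Definition galg_lmul e : 'End(galg k gT) :=
  linfun (e \*o idfun : {linear galg k gT -> galg k gT}).

Lemma galg_lmulE e a : galg_lmul e a = e * a.
Proof. by rewrite lfunE. Qed.

(** If the images were equal, [f] would be of the form [e * a], whence [f = e * f = e]. The
    dimension serves as the measure for splitting idempotents. *)
Lemma idem_dim_lt e f :
    e * e = e -> f * f = f -> e * f = e -> f * e = e -> e != f ->
  (\dim (limg (galg_lmul e)) < \dim (limg (galg_lmul f)))%N.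
Proof.
move=> Ie If ef fe nef.
have sef : (limg (galg_lmul e) <= limg (galg_lmul f))%VS.
  apply/subvP=> _ /memv_imgP[a _ ->]; rewrite galg_lmulE -fe -mulrA.
  by rewrite -[f * _]galg_lmulE memv_img ?memvf.
rewrite ltn_neqAle dimvS // andbT; apply: contra nef => /eqP eq_dim.
have : f \in limg (galg_lmul e).
  have -> : limg (galg_lmul e) = limg (galg_lmul f).
    by apply/eqP; rewrite eqEdim sef eq_dim leqnn.
  by rewrite -{1}If -[f * _]galg_lmulE memv_img ?memvf.
case/memv_imgP=> a _; rewrite galg_lmulE => fE.
by rewrite -{1}ef {1}fE mulrA Ie -fE.
Qed.

(** Descent on [e]. If [e] is not primitive, it is the sum of orthogonal central idempotents [f] and
    [e - f]. The block [b] is either fixed or killed by [Br K Q f]; in the second case it is fixed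
    by [Br K Q (e - f)]. *)
Lemma ex_block_below K H Q e b :
    p.-group Q -> (Q * 'C_K(Q))%g \subset H -> H \subset 'N_K(Q) ->
    is_block H b -> central_idem K e -> Br K Q e * b = b ->
  exists c, [/\ is_block K c, e * c = c & Br K Q c * b = b].
Proof.
move=> pQ sQH nQH blkb; move: {2}(\dim _).+1 (ltnSn (\dim (limg (galg_lmul e)))) => n.
elim: n e => // n IHn e le_n idemE brE.
have [_ nzb _] := blkb; move: (nQH); rewrite subsetI => /andP[sHK nQ].
have [sQK sCH] : Q \subset K /\ 'C_K(Q) \subset H.
  split; last exact: subset_trans (mulG_subr _ _) sQH.
  exact: subset_trans (mulG_subl _ _) (subset_trans sQH _).
have [blkE|] := pselect (is_block K e); first by exists e; case: idemE.
have [Ke Ze Ie] := idemE.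
have nz_e : e != 0.
  apply: contraNneq nzb => e0; rewrite -brE e0; apply/eqP.
  by rewrite (_ : Br _ _ _ = 0) ?mul0r //; apply/ffunP=> x; rewrite !ffunE if_same.
move=> nblk; have [f [idemF fe nz_f nef]] :
    exists f, [/\ central_idem K f, f * e = f, f != 0 & f != e].
  apply: contrapT => nex; apply: nblk; split=> // f idemF fe.
  have [->|nzf] := eqVneq f 0; first by left.
  have [->|nef] := eqVneq f e; first by right.
  by case: nex; exists f.
have [Kf Zf If] := idemF; have ef : e * f = f by rewrite Ze.
have below g : central_idem K g -> g * e = g -> e * g = g -> g != e ->
    Br K Q g * b = b -> exists c, [/\ is_block K c, e * c = c & Br K Q c * b = b].
  move=> idemG ge eg nge brG; case: (IHn g) => // [|c [blkc gc brc]].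
    by rewrite -ltnS (leq_trans _ le_n) // ltnS idem_dim_lt //; case: idemG.
  by exists c; split=> //; rewrite -gc mulrA eg.
have idemBr : central_idem H (Br K Q f).
  exact: (Br_central_idem charkp).
have [brf|brf] := block_mul_idem blkb idemBr; last exact: (below f).
apply: (below (e - f)).
- split; first exact: in_galgB.
    by move=> a Ka; rewrite mulrBl mulrBr Ze ?Zf.
  by rewrite mulrBl !mulrBr Ie fe ef If subrr subr0.
- by rewrite mulrBl Ie fe.
- by rewrite mulrBr Ie ef.
- by rewrite -subr_eq0 addrAC subrr add0r oppr_eq0.
by rewrite BrB mulrBl brf subr0.
Qed.

Lemma block_induces_at G H P B b :
    p.-group P -> (P * 'C_G(P))%g \subset H -> H \subset 'N_G(P) ->
  block_induces p G B H b -> Br G P B * b = b.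
Proof.
move=> pP sPH nPH [[idemB _ _] blkb [Q [pQ sQH nQH brQ]]].
by rewrite (Br_indep charkp pP sPH nPH pQ sQH nQH).
Qed.

(** Distinct blocks are orthogonal, and then multiplicativity of the Brauer morphism at a common
    subgroup [P] would give [b = Br G P (B1 * B2) * b = 0]. *)
Lemma block_induces_inj G H B1 B2 b :
  block_induces p G B1 H b -> block_induces p G B2 H b -> B1 = B2.
Proof.
move=> ind1 ind2; have [blk1 [_ nzb _] [P [pP sPH nPH br1]]] := ind1.
have br2 := block_induces_at pP sPH nPH ind2.
have [[blk2 _ _] [[G1 _ _] _ _]] := (ind2, blk1).
have sPG : P \subset G.
  exact: subset_trans (mulG_subl _ _) (subset_trans sPH (subset_trans nPH (subsetIl _ _))).
have conjP B x y : is_block G B -> x \in P -> B (y ^ x)%g = B y.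
  by case=> idemB _ _ /(subsetP sPG); apply: central_conj.
apply: (block_orth blk1 blk2); apply: contraNneq nzb => B12; apply/eqP.
rewrite -br1 -br2 mulrA -(Br_mul charkp pP) // ?B12; try by move=> *; apply: conjP.
by rewrite (_ : Br _ _ _ = 0) ?mul0r //; apply/ffunP=> x; rewrite !ffunE if_same.
Qed.

End BlockInduction.

(** * Transport along isomorphisms *)

Section Transport.
Import mathcomp.boot.fintype mathcomp.boot.finset.
Variable k : fieldType.

Section GalgMap.
Variables (gT rT : finGroupType) (G : {group gT}) (phi : {morphism G >-> rT}).
Hypothesis injphi : 'injm phi.
Implicit Types (L K P : {group gT}) (a b e : galg k gT).

Lemma mem_injm_morphim (A : {set gT}) x :
  x \in G -> (phi x \in phi @* A) = (x \in A).
Proof.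
move=> Gx; apply/idP/idP => [/morphimP[z Gz Az /(injmP injphi)->] // | Ax].
by rewrite mem_morphim.
Qed.

Lemma galg_mapE a x : x \in G -> galg_map phi a (phi x) = a x.
Proof.
move=> Gx; rewrite ffunE (big_pred1 x) // => y.
apply/andP/eqP=> [[Gy /eqP/(injmP injphi)->] // | -> //].
Qed.

Lemma galg_map_out a y : y \notin phi @* G -> galg_map phi a y = 0.
Proof.
move=> nGy; rewrite ffunE big_pred0 // => x; apply/negP=> /andP[Gx /eqP yx].
by case/negP: nGy; rewrite -yx mem_morphim.
Qed.

Lemma in_galg_map L a :
  L \subset G -> in_galg L a -> in_galg (phi @* L) (galg_map phi a).
Proof.
move=> sLG La y nLy; have [/morphimP[x Gx _ yE]|] := boolP (y \in phi @* G).
  move: nLy; rewrite {}yE galg_mapE // => nLy; apply: La.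
  by apply: contra nLy => Lx; rewrite mem_morphim.
exact: galg_map_out.
Qed.

Lemma galg_mapM a b : in_galg G a -> in_galg G b ->
  galg_map phi (a * b) = galg_map phi a * galg_map phi b.
Proof.
move=> Ga Gb; have sGG := subxx G; apply/ffunP=> y.
have [/morphimP[x Gx _ ->]|nGy] := boolP (y \in phi @* G); last first.
  rewrite galg_map_out //; apply/esym.
  by apply: (in_galgM (G := (phi @* G)%G)) nGy; apply: in_galg_map.
rewrite galg_mapE // !galg_mulE [LHS](bigID (mem G)) /= [X in _ + X]big1 ?addr0.
  rewrite [RHS](bigID (mem (phi @* G))) /= [X in _ + X]big1 ?addr0.
    rewrite morphimEdom big_imset /=; last by move=> u v; apply: (injmP injphi).
    apply: eq_bigr => z Gz; rewrite galg_mapE // -morphV // -morphM ?groupV //.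
    by rewrite galg_mapE // groupM ?groupV.
  by move=> z nGz; rewrite galg_map_out ?mul0r.
by move=> z nGz; rewrite Ga ?mul0r.
Qed.

Lemma galg_mapK a :
  in_galg G a -> galg_map (invm injphi) (galg_map phi a) = a.
Proof.
move=> Ga; apply/ffunP=> x; rewrite ffunE.
have [Gx|nGx] := boolP (x \in G).
  rewrite (big_pred1 (phi x)) ?galg_mapE // => y.
  apply/andP/eqP=> [[/morphimP[z Gz _ ->]] | ->].
    by rewrite /= invmE // => /eqP->.
  by rewrite mem_injm_morphim //= invmE ?Gx /=.
rewrite big_pred0 ?Ga // => y; apply/negP=> /andP[/morphimP[z Gz _ ->]].
by rewrite /= invmE // => /eqP zx; rewrite -zx Gz in nGx.
Qed.

Lemma galg_mapVK (b : galg k rT) :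
  in_galg (phi @* G)%G b -> galg_map phi (galg_map (invm injphi) b) = b.
Proof.
move=> Gb; apply/ffunP=> y.
have [/morphimP[x Gx _ ->]|nGy] := boolP (y \in phi @* G); last first.
  by rewrite galg_map_out ?Gb.
rewrite galg_mapE // ffunE (big_pred1 (phi x)) // => y'.
apply/andP/eqP=> [[/morphimP[z Gz _ ->]] | ->].
  by rewrite /= invmE // => /eqP->.
by rewrite mem_injm_morphim //= invmE ?Gx /=.
Qed.

Lemma galg_map_Br K P a : K \subset G -> P \subset G ->
  galg_map phi (Br K P a) = Br (phi @* K) (phi @* P) (galg_map phi a).
Proof.
move=> sKG sPG; apply/ffunP=> y.
have [/morphimP[x Gx _ ->]|nGy] := boolP (y \in phi @* G); last first.
  by rewrite galg_map_out // ffunE galg_map_out // if_same.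
rewrite galg_mapE // [LHS]ffunE [RHS]ffunE galg_mapE // -injm_subcent //.
by rewrite mem_injm_morphim.
Qed.

Lemma galg_map_restrm L (sLG : L \subset G) a :
  in_galg L a -> galg_map (restrm sLG phi) a = galg_map phi a.
Proof.
move=> La; apply/ffunP=> y; rewrite !ffunE /= [RHS]big_mkcond [LHS]big_mkcond /=.
apply: eq_bigr => x _; have [Lx|/La->] := boolP (x \in L).
  by rewrite (subsetP sLG).
by rewrite if_same.
Qed.

End GalgMap.

Section GalgMapCentral.
Variables (gT rT : finGroupType) (G : {group gT}) (phi : {morphism G >-> rT}).
Hypothesis injphi : 'injm phi.
Implicit Types (L K P : {group gT}) (a b e : galg k gT).

Lemma in_galg_map_inv L (a : galg k rT) : L \subset G ->
  in_galg (phi @* L) a -> in_galg L (galg_map (invm injphi) a).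
Proof.
move=> sLG La; have := in_galg_map (injm_invm injphi) (morphimS phi sLG) La.
by rewrite (_ : (_ @* _)%G = L) //; apply: group_inj; rewrite /= morphim_invm.
Qed.

Lemma galg_map_central L e : L \subset G ->
  central_idem L e -> central_idem (phi @* L) (galg_map phi e).
Proof.
move=> sLG [Le Ze Ie]; have Ge := in_galgS sLG Le.
split; first exact: in_galg_map.
  move=> a La; have La' := in_galg_map_inv sLG La.
  have Ga : in_galg (phi @* G)%G a by apply: in_galgS (morphimS phi sLG) La.
  rewrite -(galg_mapVK injphi Ga).
  have Ga' := in_galgS sLG La'.
  by rewrite -(galg_mapM injphi Ge Ga') -(galg_mapM injphi Ga' Ge) Ze.
by rewrite -(galg_mapM injphi Ge Ge) Ie.
Qed.

End GalgMapCentral.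

Section GalgMapBlocks.
Variables (gT rT : finGroupType) (G : {group gT}) (phi : {morphism G >-> rT}).
Hypothesis injphi : 'injm phi.
Implicit Types (L K P : {group gT}) (a b e : galg k gT).

Lemma galg_map_central_inv L (e : galg k rT) : L \subset G ->
  central_idem (phi @* L) e -> central_idem L (galg_map (invm injphi) e).
Proof.
move=> sLG idemE.
have := galg_map_central (injm_invm injphi) (morphimS phi sLG) idemE.
by rewrite (_ : (_ @* _)%G = L) //; apply: group_inj; rewrite /= morphim_invm.
Qed.

(** Primitivity is transported by pulling a central idempotent below the image back along
    [invm injphi]. *)
Lemma galg_map_block L b : L \subset G ->
  is_block L b -> is_block (phi @* L) (galg_map phi b).
Proof.
move=> sLG [idemb nzb prb]; have [Lb _ _] := idemb.
have Gb := in_galgS sLG Lb.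
split; first exact: galg_map_central.
  apply: contraNneq nzb => b0; rewrite -(galg_mapK injphi Gb) b0.
  by apply/eqP/ffunP=> x; rewrite !ffunE big1 // => y _; rewrite ffunE.
move=> e idemE eb; have idemE' := galg_map_central_inv sLG idemE.
have [Le _ _] := idemE; have [Le' _ _] := idemE'.
have Ge : in_galg (phi @* G)%G e by apply: in_galgS (morphimS phi sLG) Le.
have eK := galg_mapVK injphi Ge.
case: (prb _ idemE') => [|e0|eb'].
- have Ge' := in_galgS sLG Le'.
  by rewrite -[LHS](galg_mapK injphi (in_galgM Ge' Gb)) (galg_mapM injphi Ge' Gb) eK eb.
- by left; rewrite -eK e0; apply/ffunP=> x; rewrite !ffunE big1 // => y _; rewrite ffunE.
by right; rewrite -eK eb'.
Qed.

Lemma galg_map_induces p K L B b : K \subset G ->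
  block_induces p K B L b ->
  block_induces p (phi @* K) (galg_map phi B) (phi @* L) (galg_map phi b).
Proof.
move=> sKG [blkB blkb [P [pP sPL nPL brb]]].
have sLK : L \subset K by apply: subset_trans nPL (subsetIl _ _).
have sLG := subset_trans sLK sKG.
have sPG : P \subset G.
  exact: subset_trans (mulG_subl _ _) (subset_trans sPL sLG).
split; try exact: galg_map_block.
exists (phi @* P)%G; split; first exact: morphim_pgroup.
- by rewrite /= -injm_subcent // -morphimMl // morphimS.
- by rewrite /= -injm_subnorm // morphimS.
have [[Lb _ _] _ _] := blkb.
rewrite -galg_map_Br // -galg_mapM ?brb //; last exact: in_galgS Lb.
apply: (in_galgS sKG) => x nKx; rewrite ffunE ifN //.
by apply: contra nKx => /setIP[].
Qed.

End GalgMapBlocks.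
End Transport.

(** * Sums over radical subgroups *)

Section RadicalSums.
Import mathcomp.boot.fintype mathcomp.boot.finset.
Variables (k : fieldType) (U : zmodType) (p : nat).

Lemma fsbig_galg_map (gT rT : finGroupType) (G : {group gT})
    (phi : {morphism G >-> rT}) (injphi : 'injm phi)
    (X : set (galg k gT)) (Y : set (galg k rT))
    (u : galg k gT -> U) (v : galg k rT -> U) :
    (forall b, X b -> in_galg G b) -> (forall b, Y b -> in_galg (phi @* G) b) ->
    (forall b, X b -> Y (galg_map phi b)) ->
    (forall b, Y b -> X (galg_map (invm injphi) b)) ->
    (forall b, X b -> v (galg_map phi b) = u b) ->
  \sum_(b \in Y) v b = \sum_(b \in X) u b.
Proof.
move=> XG YG XY YX vu; rewrite (reindex_fsbig (galg_map phi) X Y).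
  by apply: eq_fsbigr => b /set_mem/vu.
split=> [b Xb | b c /set_mem Xb /set_mem Xc bc | b Yb]; first exact: XY.
  by rewrite -(galg_mapK injphi (XG _ Xb)) bc galg_mapK //; apply: XG.
by exists (galg_map (invm injphi) b); [apply: YX | apply/galg_mapVK/YG].
Qed.

(** [iso_constant] concerns isomorphisms defined on the group of the pair itself, so [phi] has to be
    restricted to [L]. *)
Lemma iso_constant_sub (F : pairs k) (f : pairfun k U) (gT rT : finGroupType)
    (G L : {group gT}) (phi : {morphism G >-> rT}) b :
    'injm phi -> iso_constant F f -> L \subset G -> in_galg L b ->
    F gT L b -> F rT (phi @* L)%G (galg_map phi b) ->
  f rT (phi @* L)%G (galg_map phi b) = f gT L b.
Proof.
move=> injphi isof sLG Lb FL FphiL; apply/esym.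
apply: (isof _ _ _ _ _ _ (restrm_morphism sLG phi)) => //.
  by apply/isomP; rewrite injm_restrm // im_restrm.
exact: galg_map_restrm.
Qed.

Lemma morphim_invm_group (gT rT : finGroupType) (G L : {group gT})
    (phi : {morphism G >-> rT}) (injphi : 'injm phi) :
  L \subset G -> (invm injphi @* (phi @* L))%G = L.
Proof. by move=> sLG; apply: group_inj; rewrite /= morphim_invm. Qed.

Lemma radical_isom (gT rT : finGroupType) (G Q : {group gT})
    (phi : {morphism G >-> rT}) :
  'injm phi -> radical p G Q -> radical p (phi @* G) (phi @* Q).
Proof.
move=> injphi /and3P[sQG pQ /eqP radQ]; apply/and3P; split.
- exact: morphimS.
- exact: morphim_pgroup.
by rewrite /= -injm_subnorm // -injm_pcore ?subsetIl // -radQ.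
Qed.

(** Central elements of the group algebra are class functions. *)
Lemma conjgm_galg_map (gT : finGroupType) (G : {group gT}) x (B : galg k gT) :
  x \in G -> central_idem G B -> galg_map (conjgm_morphism G x) B = B.
Proof.
move=> Gx idemB; have [GB _ _] := idemB; apply/ffunP=> y.
have [Gy|nGy] := boolP (y \in G).
  by rewrite -[y in LHS](conjgKV x) galg_mapE ?injm_conj ?groupJ ?groupV //=
             (central_conj _ idemB) ?groupV.
rewrite GB // galg_map_out // morphim_conj setIid.
by rewrite (normsP (normG G) x Gx).
Qed.

Variable F : pairs k.
Hypothesis famF : is_family p F.

Definition radical_term (h : pairfun k U) (gT : finGroupType) (G : {group gT})
    (B : galg k gT) (Q : {group gT}) : U :=
  \sum_(b \in [set b | block_induces p G B 'N_G(Q)%G b]%classic)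
    h gT 'N_G(Q)%G b.

Lemma radical_term_isom (h : pairfun k U) (gT rT : finGroupType)
    (G Q : {group gT}) (phi : {morphism G >-> rT}) B :
    'injm phi -> iso_constant F h -> Q \subset G ->
    F G B -> F (phi @* G)%G (galg_map phi B) ->
  radical_term h (phi @* G) (galg_map phi B) (phi @* Q) = radical_term h G B Q.
Proof.
move=> injphi isoh sQG FG FphiG.
have sNG : 'N_G(Q) \subset G by apply: subsetIl.
have nE : 'N_(phi @* G)(phi @* Q)%G = (phi @* 'N_G(Q))%G.
  by apply: group_inj; rewrite /= injm_subnorm.
have [_ [[GB _ _] _ _] closG] := famF FG; have [_ _ closphiG] := famF FphiG.
rewrite /radical_term nE; apply: (fsbig_galg_map (injphi := injphi)).
- by move=> b [_ [[Nb _ _] _ _] _]; apply: in_galgS Nb.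
- by move=> b [_ [[Nb _ _] _ _] _]; apply: in_galgS Nb; apply: morphimS.
- by move=> b; apply: galg_map_induces.
- move=> b /(galg_map_induces (injm_invm injphi) (subxx _)).
  by rewrite galg_mapK // !morphim_invm_group.
move=> b indb; have [_ [[Nb _ _] _ _] _] := indb.
apply: (iso_constant_sub injphi isoh) => //; first exact: closG.
by apply: closphiG; [apply: morphimS | apply: galg_map_induces].
Qed.

Variables f h : pairfun k U.
Hypothesis freeU : free_abelian U.
Hypothesis isoh : iso_constant F h.
Hypothesis f_eq : forall (gT : finGroupType) (G : {group gT}) (B : galg k gT),
  F G B ->
  exists2 T : {set {group gT}}, radical_reps p G T &
    f G B = \sum_(Q in T | Q :!=: 1%g) radical_term h G B Q.

(** Conjugation by an element of [G] fixes [B], so the terms are constant on orbits, and the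
    stabiliser of [Q] is its normaliser. The right-hand side no longer involves a choice of
    representatives. *)
Lemma radical_sum (gT : finGroupType) (G : {group gT}) (B : galg k gT) :
    F G B ->
  f G B *+ #|G| =
    \sum_(Q : {group gT} | radical p G Q && (Q :!=: 1%g)) radical_term h G B Q *+ #|'N_G(Q)|.
Proof.
move=> FG; have [T repT ->] := f_eq FG.
have [_ [idemB _ _] _] := famF FG.
have conjG x : x \in G -> (conjgm G x @* G)%G = G.
  by move=> Gx; apply: group_inj; rewrite /= norm_conjg_im // (subsetP (normG G)).
have conjQ x (Q : {group gT}) : Q \subset G -> (conjgm G x @* Q)%G = (Q :^ x)%G.
  by move=> sQG; apply: group_inj; rewrite /= morphim_conj (setIidPr sQG).
(* The value 0 at the trivial subgroup encodes the condition [Q :!=: 1%g], as [sum_transversal] sums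
   over all representatives. *)
pose phi (Q : {group gT}) := if Q :==: 1%g then 0 else radical_term h G B Q.
have radJ x (Q : {group gT}) : x \in G -> radical p G Q -> radical p G (Q :^ x)%G.
  move=> Gx radQ; have := radical_isom (injm_conj G x) radQ.
  by rewrite conjG // conjQ //; case/and3P: radQ.
rewrite big_mkcondr /= (eq_bigr phi) => [|Q _]; last by rewrite /phi; case: eqP.
rewrite (sum_transversal _ repT) => [|| Q x].
- rewrite big_mkcondr /=; apply: eq_big => [Q | Q _]; first by rewrite inE.
  by rewrite astab1JG /phi; case: eqP => //=; rewrite mul0rn.
- apply/actsP=> x Gx Q; rewrite !inE; apply/idP/idP; last exact: radJ.
  move/(radJ _ _ (groupVr Gx)); congr radical; apply: group_inj.
  by rewrite /= conjsgK.
rewrite inE => /and3P[sQG _ _] Gx; rewrite /phi /=.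
rewrite (_ : (Q :^ x == 1)%g = (Q :==: 1%g)); last first.
  by apply/eqP/eqP=> [/(congr1 (fun A => A :^ x^-1))|->]; rewrite ?conjsgK ?conjs1g.
case: eqP => // _; have := radical_term_isom (injm_conj G x) isoh sQG FG.
by rewrite conjgm_galg_map // conjG // conjQ //; apply.
Qed.

(** The representatives chosen in [G] and [H] need not correspond under [phi], but the sums over all
    radical subgroups given by [radical_sum] do. The factor [#|G|] is then cancelled. *)
Lemma f_iso : iso_constant F f.
Proof.
move=> gT rT G H B B' phi FG FH /isomP[injphi imphi] BB'.
have HE : H = (phi @* G)%G by apply: group_inj.
subst H B'.
apply: (mulrn_inj freeU (cardG_gt0 G)); rewrite -{2}(card_injm injphi (subxx G)).
rewrite !radical_sum //.
rewrite [RHS](reindex_onto (fun Q : {group gT} => (phi @* Q)%G)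
  (fun Q : {group rT} => (invm injphi @* Q)%G)) /=; last first.
  move=> Q /andP[/and3P[sQ _ _] _]; apply: group_inj => /=.
  by rewrite morphim_invmE // morphpreK.
apply: eq_big => [Q | Q /andP[/and3P[sQG _ _] _]]; last first.
  by rewrite radical_term_isom // -injm_subnorm // card_injm // subsetIl.
apply/idP/idP => [/andP[radQ ntQ] | /andP[/andP[radQ ntQ] /eqP Qinv]].
  have [sQG _ _] := and3P radQ.
  by rewrite radical_isom //= morphim_injm_eq1 // ntQ morphim_invm_group //=.
have := radical_isom (injm_invm injphi) radQ.
have sQG : Q \subset G.
  rewrite -Qinv /=; apply: subset_trans (morphim_sub _ _) _.
  by rewrite im_invm.
by rewrite !morphim_invm_group // => ->; rewrite -(morphim_injm_eq1 injphi).
Qed.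

End RadicalSums.

(** * Chains *)

(** Reindexing along [s] shows that the sum is its own opposite, so its double vanishes; fixed
    points of [s] are covered by the same argument. *)
Lemma involution_sum0 (U : zmodType) (I : finType) (P : pred I) (s : I -> I)
    (phi : I -> U) :
    free_abelian U -> (forall x, P x -> P (s x)) ->
    (forall x, P x -> s (s x) = x) -> (forall x, P x -> phi (s x) = - phi x) ->
  \sum_(x | P x) phi x = 0.
Proof.
move=> freeU Ps sK phis; apply: (free_abelian_torsion_free freeU (n := 2)) => //.
rewrite mulr2n {2}(reindex_onto s s sK) /= -[X in _ + X]opprK -sumrN.
apply/eqP; rewrite subr_eq0; apply/eqP; apply: eq_big => [x | x Px].
  apply/idP/andP => [Px | [Psx /eqP <-]]; last exact: Ps.
  by rewrite Ps // sK.
by rewrite phis ?opprK.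
Qed.

Section Toggle.
Import mathcomp.boot.fintype mathcomp.boot.finset.
Variable T : finType.
Implicit Types (x y : T) (C : {set T}).

Definition toggle x C := if x \in C then C :\ x else x |: C.

Lemma in_toggle x C y : (y \in toggle x C) = if y == x then x \notin C else y \in C.
Proof.
by rewrite /toggle; case: ifP => xC; rewrite !inE; case: eqP => //= ->.
Qed.

Lemma toggleK x : involutive (toggle x).
Proof.
by move=> C; apply/setP=> y; rewrite !in_toggle eqxx; case: eqP => // ->; rewrite negbK.
Qed.

(** The element [y], which stays in the set, keeps both cardinals positive, so that [.-1] does not
    truncate. For chains [y] is the trivial subgroup. *)
Lemma toggle_sign (R : pzRingType) x y C : y \in C -> y != x ->
  (-1) ^+ #|toggle x C|.-1 = - (-1) ^+ #|C|.-1 :> R.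
Proof.
move=> Cy yx; have sgn (D : {set T}) : y \in D -> x \notin D ->
    (-1) ^+ #|x |: D|.-1 = - (-1) ^+ #|D|.-1 :> R.
  move=> Dy xD; rewrite cardsU1 xD add1n /= -[RHS]mulN1r -exprS prednK //.
  by rewrite card_gt0; apply/set0Pn; exists y.
rewrite /toggle; case: ifP => xC; last by rewrite sgn ?xC.
by rewrite -{2}(setD1K xC) sgn ?opprK // !inE ?eqxx // yx.
Qed.

End Toggle.

Section Chains.
Import mathcomp.boot.fintype mathcomp.boot.finset.
Variables (p : nat) (gT : finGroupType) (G : {group gT}).
Implicit Types (C : {set {group gT}}) (Q P M D : {group gT}).

Lemma chain_sub C Q : is_chain p G C -> Q \in C -> Q \subset G.
Proof. by case/and3P=> _ /forall_inP/(_ Q) chC _ /chC/andP[]. Qed.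

Lemma chain_pgroup C Q : is_chain p G C -> Q \in C -> p.-group Q.
Proof. by case/and3P=> _ /forall_inP/(_ Q) chC _ /chC/andP[]. Qed.

Lemma chain_total C P Q :
  is_chain p G C -> P \in C -> Q \in C -> (P \subset Q) || (Q \subset P).
Proof. by case/and3P=> _ _ /forall_inP chC CP /(forall_inP (chC P CP)). Qed.

Lemma chain_total_proper C P Q :
  is_chain p G C -> P \in C -> Q \in C -> P != Q -> (P \proper Q) || (Q \proper P).
Proof.
move=> chC CP CQ nPQ; have := chain_total chC CP CQ.
have ne (A B : {group gT}) : A != B -> A \subset B -> A \proper B.
  by move=> nAB sAB; rewrite properEneq sAB andbT.
case/orP=> [/(ne _ _ nPQ)-> // | ]; rewrite eq_sym in nPQ.
by move/(ne _ _ nPQ)->; rewrite orbT.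
Qed.

Lemma chain_topP C : is_chain p G C ->
  chain_top C \in C /\ forall Q, Q \in C -> Q \subset chain_top C.
Proof.
move=> chC; have [C1 _ _] := and3P chC; rewrite /chain_top.
case: arg_maxnP => // T CT maxT; split=> // Q CQ.
case/orP: (chain_total chC CQ CT) => // sTQ.
by have /eqP <- : T == Q :> {set gT} by rewrite eqEcard sTQ; apply: maxT.
Qed.

Lemma chain_top_eq C T : is_chain p G C -> T \in C ->
  (forall Q, Q \in C -> Q \subset T) -> chain_top C = T.
Proof.
move=> chC CT maxT; have [Ctop maxtop] := chain_topP chC.
by apply/group_inj/eqP; rewrite eqEsubset maxT ?maxtop.
Qed.

Lemma chain_stabP C x : is_chain p G C ->
  reflect (x \in G /\ forall Q, Q \in C -> x \in 'N(Q)) (x \in chain_stab G C).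
Proof.
move=> chC; have [C1 _ _] := and3P chC.
apply: (iffP bigcapP) => [stabx | [Gx nx] Q CQ]; last by rewrite inE Gx nx.
split=> [|Q /stabx]; last by case/setIP.
by case/setIP: (stabx _ C1).
Qed.

Lemma chain_stab_sub C : is_chain p G C -> chain_stab G C \subset G.
Proof. by move=> chC; apply/subsetP=> x /(chain_stabP _ chC)[]. Qed.

Lemma chain_stab_norm C Q :
  is_chain p G C -> Q \in C -> chain_stab G C \subset 'N(Q).
Proof. by move=> chC CQ; apply/subsetP=> x /(chain_stabP _ chC)[_]; apply. Qed.

Definition low_norm C M : {group gT} :=
  (M :&: \bigcap_(Q in C | Q \proper M) 'N(Q))%G.

Lemma low_normP C M x :
  reflect (x \in M /\ forall Q, Q \in C -> Q \proper M -> x \in 'N(Q))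
          (x \in low_norm C M).
Proof.
apply: (iffP setIP) => [[Mx /bigcapP nx] | [Mx nx]]; split=> //.
  by move=> Q CQ ltQM; apply: nx; rewrite CQ.
by apply/bigcapP=> Q /andP[]; apply: nx.
Qed.

Lemma low_norm_sub C M : low_norm C M \subset M.
Proof. exact: subsetIl. Qed.

(** Phrased by [low_norm] so that a failure has a least failing term. For chains it amounts to every
    term lying in the stabiliser, by [normal_chain_stab] and [normal_chainP]. *)
Definition normal_chain C := [forall M in C, low_norm C M == M].

Definition first_fail C M :=
  [&& M \in C, low_norm C M != M
    & [forall Q in C, (Q \proper M) ==> (low_norm C Q == Q)]].

Lemma first_fail_uniq C M1 M2 :
  is_chain p G C -> first_fail C M1 -> first_fail C M2 -> M1 = M2.
Proof.
move=> chC /and3P[CM1 f1 /forall_inP l1] /and3P[CM2 f2 /forall_inP l2].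
apply/eqP/negPn/negP => /(chain_total_proper chC CM1 CM2).
case/orP=> lt12; first by have := l2 _ CM1; rewrite lt12 (negPf f1).
by have := l1 _ CM2; rewrite lt12 (negPf f2).
Qed.

Lemma ex_first_fail C : ~~ normal_chain C -> exists M, first_fail C M.
Proof.
case/forall_inPn=> M0 CM0 fM0.
pose fails M := (M \in C) && (low_norm C M != M).
have P0 : fails M0 by rewrite /fails CM0.
case: (arg_minnP (fun M : {group gT} => #|M|) P0) => M /andP[CM fM] minM.
exists M; rewrite /first_fail CM fM /=; apply/forall_inP=> Q CQ.
apply/implyP=> ltQM; apply: contraLR (proper_card ltQM) => fQ.
by rewrite -leqNgt minM // /fails CQ.
Qed.

Lemma normal_chain_norm C P Q : is_chain p G C -> normal_chain C ->
  P \in C -> Q \in C -> P \subset 'N(Q).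
Proof.
move=> chC /forall_inP nC CP CQ; have [->|] := eqVneq P Q; first exact: normG.
case/(chain_total_proper chC CP CQ)/orP=> [ltPQ | ltQP].
  exact: subset_trans (proper_sub ltPQ) (normG Q).
apply/subsetP=> x; rewrite -(eqP (nC _ CP)) => /low_normP[_]; exact.
Qed.

Lemma normal_chain_stab C Q : is_chain p G C -> normal_chain C ->
  Q \in C -> Q \subset chain_stab G C.
Proof.
move=> chC nC CQ; apply/subsetP=> x Qx; apply/(chain_stabP _ chC).
split=> [|P CP]; first exact: (subsetP (chain_sub chC CQ)).
exact: (subsetP (normal_chain_norm chC nC CQ CP)).
Qed.

Lemma normal_chainP C : is_chain p G C ->
  (forall Q, Q \in C -> Q \subset chain_stab G C) -> normal_chain C.
Proof.
move=> chC stabC; apply/forall_inP=> M CM; apply/eqP/group_inj/eqP.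
rewrite eqEsubset low_norm_sub; apply/subsetP=> x Mx; apply/low_normP.
split=> // Q CQ _; apply: subsetP Mx.
exact: subset_trans (stabC _ CM) (chain_stab_norm chC CQ).
Qed.

Lemma is_chain_toggle C D : is_chain p G C -> D != 1%G -> D \subset G -> p.-group D ->
    (forall Q, Q \in C -> (D \subset Q) || (Q \subset D)) ->
  is_chain p G (toggle D C).
Proof.
move=> chC ntD sDG pD cmpD; have [C1 _ _] := and3P chC; apply/and3P; split.
- by rewrite in_toggle eq_sym (negPf ntD).
- apply/forall_inP=> Q; rewrite in_toggle; case: eqP => [-> _ | _ CQ].
    by rewrite sDG.
  by rewrite (chain_sub chC CQ) (chain_pgroup chC CQ).
apply/forall_inP=> Q; rewrite in_toggle => CQ; apply/forall_inP=> P.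
rewrite in_toggle => CP; case: eqP CQ => [-> _ | _ CQ]; case: eqP CP => [-> _| _ CP].
- by rewrite subxx.
- exact: cmpD.
- by rewrite orbC cmpD.
exact: (chain_total chC CQ CP).
Qed.

(** * Toggling at the first term not normalising the smaller ones *)

Section Fail.
Variables (C : {set {group gT}}) (M : {group gT}).
Hypotheses (chC : is_chain p G C) (failM : first_fail C M).
Let D := low_norm C M.
Let C' := toggle D C.

Lemma fail_proper : D \proper M.
Proof.
have [_ fM _] := and3P failM; rewrite properEneq low_norm_sub andbT.
by apply: contra fM => /eqP/group_inj DM; apply/eqP.
Qed.

(** [Q] normalises the larger terms because it lies in them, and the smaller ones because [M] is the
    first failure. Hence [D] fits into the chain just below [M]. *)
Lemma fail_below Q : Q \in C -> Q \proper M -> Q \subset D.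
Proof.
have [CM _ /forall_inP low] := and3P failM.
move=> CQ ltQM; apply/subsetP=> x Qx; apply/low_normP.
split=> [|P CP ltPM]; first exact: (subsetP (proper_sub ltQM)).
case: (eqVneq Q P) Qx => [-> | nQP Qx]; first exact: (subsetP (normG P)).
case/orP: (chain_total_proper chC CQ CP nQP) => [ltQP | ltPQ].
  by apply: (subsetP (normG P)); apply: (subsetP (proper_sub ltQP)).
have /eqP QE := implyP (low _ CQ) ltQM.
by move: Qx; rewrite -{1}QE => /low_normP[_]; apply.
Qed.

(** If [D] were trivial, so would be every term below [M], and [M] would normalise them all. *)
Lemma fail_nontriv : D != 1%G.
Proof.
have [CM fM _] := and3P failM; apply: contra fM => /eqP D1.
apply/eqP/group_inj/eqP; rewrite eqEsubset low_norm_sub; apply/subsetP=> x Mx.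
apply/low_normP; split=> // Q CQ ltQM.
have := fail_below CQ ltQM; rewrite D1 => /trivGP ->.
by rewrite norm1 inE.
Qed.

Lemma fail_chain : is_chain p G C'.
Proof.
have [CM _ _] := and3P failM; have sDM := low_norm_sub C M.
apply: is_chain_toggle => //; first exact: fail_nontriv.
- exact: subset_trans sDM (chain_sub chC CM).
- exact: pgroupS sDM (chain_pgroup chC CM).
move=> Q CQ; have [->|] := eqVneq Q M; first by rewrite sDM.
case/(chain_total_proper chC CQ CM)/orP=> [ltQM | ltMQ].
  by rewrite fail_below // orbT.
by rewrite (subset_trans sDM) // proper_sub.
Qed.

(** The delicate case is the removal of [D], which could enlarge [low_norm]. An element of the new
    group that normalises [D] normalises every term of [C] below [M], so lies in [D]. A
    self-normalising subgroup of a [p]-group is the whole group. *)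
Lemma fail_low_norm : low_norm C' M = D.
Proof.
have [CM _ _] := and3P failM; have ltDM := fail_proper.
apply/group_inj/eqP; rewrite eqEsubset; apply/andP; split; last first.
  apply/subsetP=> x Dx; apply/low_normP.
  split=> [|Q]; first exact: (subsetP (low_norm_sub C M)).
  rewrite in_toggle; case: eqP => [-> _ _ | _ CQ].
    exact: (subsetP (normG D)).
  by case/low_normP: Dx => _; apply.
have [CD|nCD] := boolP (D \in C); last first.
  apply/subsetP=> x /low_normP[Mx nx]; apply/low_normP; split=> // Q CQ.
  by apply: nx; rewrite in_toggle CQ nCD if_same.
have sDK : D \subset low_norm C' M.
  apply/subsetP=> x Dx; apply/low_normP.
  split=> [|Q]; first exact: (subsetP (low_norm_sub C M)).
  rewrite in_toggle CD; case: eqP => //= _ CQ ltQM.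
  by case/low_normP: Dx => _; apply.
have pK : p.-group (low_norm C' M).
  exact: pgroupS (low_norm_sub _ _) (chain_pgroup chC CM).
suff nDK : 'N_(low_norm C' M)(D) \subset D.
  by rewrite (nilpotent_sub_norm (pgroup_nil pK) sDK nDK).
apply/subsetP=> x /setIP[/low_normP[Mx nx] nDx]; apply/low_normP.
split=> // Q CQ ltQM; have [->//|nQD] := eqVneq Q D.
by apply: nx; rewrite // in_toggle (negPf nQD).
Qed.

(** With [fail_low_norm], this makes the toggle an involution: the second application finds the same
    [M] and the same [D]. *)
Lemma fail_first_fail : first_fail C' M.
Proof.
have [CM fM /forall_inP low] := and3P failM; have ltDM := fail_proper.
apply/and3P; split.
- rewrite in_toggle; case: eqP => // MD; by rewrite MD properxx in ltDM.
- by rewrite fail_low_norm.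
apply/forall_inP=> Q; rewrite in_toggle => CQ; apply/implyP=> ltQM.
apply/eqP/group_inj/eqP; rewrite eqEsubset low_norm_sub.
apply/subsetP=> x Qx; apply/low_normP; split=> // P.
case: (eqVneq Q D) CQ => [QD _ | nQD CQ].
  rewrite in_toggle; case: eqP => [->|_ CP ltPQ]; first by rewrite QD properxx.
  move: Qx; rewrite QD => /low_normP[_]; apply=> //.
  by apply: proper_trans ltPQ ltQM.
rewrite in_toggle; case: eqP => [-> _ ltDQ|_ CP ltPQ].
  by have := proper_sub_trans ltDQ (fail_below CQ ltQM); rewrite properxx.
have /eqP QE := implyP (low _ CQ) ltQM.
by move: Qx; rewrite -{1}QE => /low_normP[_]; apply.
Qed.

(** [D] is defined from [M] and the terms below it, so whatever normalises all these normalises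
    [D]. *)
Lemma fail_stab_sub : chain_stab G C \subset chain_stab G C'.
Proof.
have [CM _ _] := and3P failM.
apply/subsetP=> x /(chain_stabP _ chC)[Gx nx].
apply/(chain_stabP _ fail_chain); split=> // Q; rewrite in_toggle.
case: eqP => [-> _ | _]; last exact: nx.
rewrite inE /= conjIg (normP (nx _ CM)) setIS // -bigcapJ.
apply/bigcapsP => P /andP[CP ltPM]; rewrite (bigcap_min P) ?CP //.
by rewrite -normJ (normP (nx _ CP)).
Qed.

Lemma fail_top : chain_top C' = chain_top C.
Proof.
have [CM _ _] := and3P failM; have [Ct topC] := chain_topP chC.
have ltDt : D \proper chain_top C.
  exact: proper_sub_trans fail_proper (topC _ CM).
apply: chain_top_eq fail_chain _ _ => [|Q].
  by rewrite in_toggle; case: eqP => // tD; rewrite -tD properxx in ltDt.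
rewrite in_toggle; case: eqP => [-> _ | _ /topC //]; exact: proper_sub.
Qed.

End Fail.

(** The converse inclusion is [fail_stab_sub] for the toggled chain, which toggles back to [C]. *)
Lemma fail_stab C M : is_chain p G C -> first_fail C M ->
  chain_stab G (toggle (low_norm C M) C) = chain_stab G C.
Proof.
move=> chC failM; apply/group_inj/eqP; rewrite eqEsubset fail_stab_sub // andbT.
have := fail_stab_sub (fail_chain chC failM) (fail_first_fail chC failM).
by rewrite fail_low_norm // toggleK.
Qed.

Definition fail_toggle C :=
  if [pick M | first_fail C M] is Some M then toggle (low_norm C M) C else C.

Lemma fail_toggleE C M : is_chain p G C -> first_fail C M ->
  fail_toggle C = toggle (low_norm C M) C.
Proof.
move=> chC failM; rewrite /fail_toggle; case: pickP => [M' failM' | /(_ M)].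
  by rewrite (first_fail_uniq chC failM failM').
by rewrite failM.
Qed.

(** [phi] sees a chain only through its stabiliser and its top, which [fail_toggle] preserves while
    it reverses the sign. *)
Lemma nonnormal_chains_sum0 (U : zmodType) (phi : {group gT} -> {group gT} -> U) :
    free_abelian U ->
  \sum_(C | is_chain p G C && ~~ normal_chain C)
     phi (chain_stab G C) (chain_top C) *~ (-1) ^+ chain_len C = 0.
Proof.
move=> freeU; apply: (involution_sum0 (s := fail_toggle)) => // C /andP[chC];
  case/ex_first_fail=> M failM; rewrite (fail_toggleE chC failM).
- rewrite fail_chain //=; apply/forall_inPn.
  have [CM fM _] := and3P (fail_first_fail chC failM).
  by exists M.
- rewrite (fail_toggleE (fail_chain chC failM) (fail_first_fail chC failM)).
  by rewrite fail_low_norm // toggleK.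
rewrite fail_stab // fail_top // /chain_len (toggle_sign _ (y := 1%G)) ?mulrNz //.
  by case/and3P: chC.
by rewrite eq_sym fail_nontriv.
Qed.

End Chains.

(** * Blocks of chain stabilisers belong to the family *)

Section ChainFamily.
Import mathcomp.boot.fintype mathcomp.boot.finset.
Variables (k : fieldType) (p : nat) (F : pairs k).
Hypotheses (charkp : p \in [pchar k]) (famF : is_family p F).

(* Going down a chain from its top, each step replaces the stabiliser [K] of
   the terms above [M] by ['N_K(M)], and [M] is contained in [K]. *)
Lemma chain_block_family (gT : finGroupType) (G : {group gT}) (B : galg k gT)
    (C : {set {group gT}}) b :
  is_chain p G C -> F G B -> chain_blocks G B C b -> F (chain_stab G C) b.
Proof.
move=> chC FG [blkb brb]; have [CT topC] := chain_topP chC.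
set T := chain_top C in CT topC brb.
have [_ [idemB _ _] closG] := famF FG.
have [sTG pT] := (chain_sub chC CT, chain_pgroup chC CT).
(* The induction runs over the subsets [D] of [C] that contain the top [T]; these may omit the
   trivial subgroup. The least term is removed at each step, until [D] is reduced to [T], where [T]
   itself witnesses the block induction to [B]. *)
have [D] : exists D : {set {group gT}},
    [/\ T \in D, D \subset C & chain_stab G D = chain_stab G C].
  by exists C.
move=> [DT sDC stabD]; rewrite -{}stabD in blkb *.
have [n] := ubnP #|D|; elim: n => // n IHn in D b blkb brb DT sDC *; rewrite ltnS => leD.
have stabT (E : {set {group gT}}) : T \in E -> E \subset C ->
    [/\ chain_stab G E \subset G, 'C_G(T) \subset chain_stab G E
      & chain_stab G E \subset 'N(T)].
  move=> ET sEC; have sN : chain_stab G E \subset 'N_G(T).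
    by apply/subsetP=> x /bigcapP/(_ _ ET).
  split; try by apply: subset_trans sN _; rewrite ?subsetIl ?subsetIr.
  apply/bigcapsP=> Q EQ; apply: setIS; apply: subset_trans (cent_sub Q).
  by apply: centS; apply: topC; apply: (subsetP sEC).
have [sHG sCH nHT] := stabT D DT sDC.
have [D0 | [M0 DM0]] := set_0Vmem (D :\ T).
  have DE : D = [set T] by rewrite -(setD1K DT) D0 setU0.
  have stabE : chain_stab G D = 'N_G(T)%G.
    by apply: group_inj; rewrite /chain_stab /= DE big_set1.
  apply: closG => //; split=> //; first by have [] := famF FG.
  exists T; split=> //; last by rewrite stabE.
  by rewrite stabE mul_subG // subsetI ?sTG ?normG ?subsetIl //= subIset // cent_sub orbT.
case: (arg_minnP (fun Q : {group gT} => #|Q|) DM0) => M /setD1P[nMT DM] minM.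
have CM := subsetP sDC _ DM; pose K := chain_stab G (D :\ M).
have sD'C : D :\ M \subset C by apply: subset_trans (subsetDl _ _) sDC.
have D'T : T \in D :\ M by rewrite !inE eq_sym nMT.
have [sKG sCK nKT] := stabT _ D'T sD'C.
have HE : chain_stab G D = 'N_K(M)%G.
  apply: group_inj; rewrite /K /chain_stab /= (big_setD1 M) //= setIC.
  rewrite [in LHS]setIA; congr (_ :&: _); apply/setIidPl; exact: sKG.
have sMK : M \subset K.
  apply/subsetP=> x Mx; apply/bigcapP=> Q /setD1P[nQM DQ].
  rewrite inE (subsetP (chain_sub chC CM)) //=.
  apply: (subsetP (normG Q)); apply: subsetP Mx.
  have CQ := subsetP sDC _ DQ.
  have [->|nQT] := eqVneq Q T; first exact: topC.
  case/orP: (chain_total chC CM CQ) => // sQM.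
  have leMQ : (#|M| <= #|Q|)%N by apply: minM; apply/setD1P.
  by have /eqP/group_inj-> : M == Q :> {set gT} by rewrite eq_sym eqEcard sQM.
have pM := chain_pgroup chC CM.
have sMCH : (M * 'C_K(M))%g \subset chain_stab G D.
  by rewrite HE mul_subG // subsetI ?sMK ?normG ?subsetIl //= subIset // cent_sub orbT.
have nHM : chain_stab G D \subset 'N_K(M) by rewrite HE.
(* [M] lies in [T], so whatever centralises [T] centralises [M]. Hence [ex_block_below] at [M]
   yields a block [c] of [K] with [b^K = c], still below [Br G T B], to which the induction
   applies. *)
have brM : Br K M (Br G T B) = Br G T B.
  apply/ffunP=> x; rewrite ffunE; case: ifPn => // nx; rewrite ffunE ifN //.
  apply: contra nx => xC; rewrite inE (subsetP sCK) //=.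
  by case/setIP: xC => _; apply: (subsetP (centS (topC _ CM))).
have [||c [blkc cE brc]] := ex_block_below charkp pM sMCH nHM blkb (e := Br G T B).
- exact: (Br_central_idem charkp).
- by rewrite brM.
have FK : F K c.
  apply: IHn => //; apply: leq_trans leD.
  by rewrite (cardsD1 M D) DM.
have [_ _ closK] := famF FK; apply: closK; first by rewrite HE subsetIl.
by split=> //; exists M.
Qed.

End ChainFamily.

(** * Conjugation of chains, and the [p]-core inside radical subgroups *)

Section ChainConjugation.
Import mathcomp.boot.fintype mathcomp.boot.finset.
Variables (p : nat) (gT : finGroupType) (G : {group gT}).
Implicit Types (C : {set {group gT}}) (Q : {group gT}).

Lemma in_chain_conj C x Q : (Q \in ('JG^*)%act C x) = ((Q :^ x^-1)%G \in C).
Proof.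
apply/imsetP/idP=> [[P CP ->] | CQ].
  by rewrite (_ : (_ :^ x^-1)%G = P) //; apply: group_inj; rewrite /= conjsgK.
by exists (Q :^ x^-1)%G => //; apply: group_inj; rewrite /= conjsgKV.
Qed.

Lemma is_chain_conj C x : x \in G -> is_chain p G C -> is_chain p G (('JG^*)%act C x).
Proof.
move=> Gx chC; have [C1 _ _] := and3P chC; apply/and3P; split.
- by rewrite in_chain_conj (_ : (1 :^ _)%G = 1%G) //; apply: group_inj; rewrite /= conjs1g.
- apply/forall_inP=> Q; rewrite in_chain_conj => CQ.
  have := chain_sub chC CQ; have := chain_pgroup chC CQ.
  rewrite /= pgroupJ => ->; rewrite -{1}(normsP (normG G) x^-1%g) ?groupV //.
  by rewrite conjSg andbT.
apply/forall_inP=> Q; rewrite in_chain_conj => CQ; apply/forall_inP=> P.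
rewrite in_chain_conj => CP; have := chain_total chC CQ CP.
by rewrite /= !conjSg.
Qed.

Lemma chain_stab_conj C x : x \in G -> is_chain p G C ->
  chain_stab G (('JG^*)%act C x) = (chain_stab G C :^ x)%G.
Proof.
move=> Gx chC; apply: group_inj; apply/setP=> y; rewrite /= mem_conjg.
apply/(chain_stabP _ (is_chain_conj Gx chC))/(chain_stabP _ chC).
  case=> Gy ny; split=> [|Q CQ]; first by rewrite groupJ ?groupV.
  have := ny (Q :^ x)%G; rewrite in_chain_conj /= normJ mem_conjg; apply.
  by rewrite (_ : (_ :^ x^-1)%G = Q) //; apply: group_inj; rewrite /= conjsgK.
case=> Gy ny; split=> [|Q]; first by rewrite groupJr ?groupV in Gy.
rewrite in_chain_conj => /ny; rewrite /= normJ mem_conjg invgK.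
by rewrite conjgKV.
Qed.

Lemma chain_top_conj C x : x \in G -> is_chain p G C ->
  chain_top (('JG^*)%act C x) = (chain_top C :^ x)%G.
Proof.
move=> Gx chC; have [CT topC] := chain_topP chC.
apply: chain_top_eq (is_chain_conj Gx chC) _ _ => [|Q].
  exact: imset_f.
by rewrite in_chain_conj => /topC; rewrite /= sub_conjgV.
Qed.

Lemma chain_len_conj C x : chain_len (('JG^*)%act C x) = chain_len C.
Proof. by rewrite /chain_len card_setact. Qed.

Lemma acts_chains : [acts G, on [set C | is_chain p G C] | ('JG^*)%act].
Proof.
apply/actsP=> x Gx C; rewrite !inE; apply/idP/idP; last exact: is_chain_conj.
by move/(is_chain_conj (groupVr Gx)); rewrite actK.
Qed.

(** An element fixing the chain as a set sends each term to a comparable term of the same order,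
    hence to itself. *)
Lemma card_chain_stab C : is_chain p G C ->
  #|'C_G[C | ('JG^*)%act]| = #|chain_stab G C|.
Proof.
move=> chC; apply: eq_card => x; apply/setIP/(chain_stabP _ chC).
  case=> Gx /astab1P stC; split=> // Q CQ; rewrite inE.
  have CQx : (Q :^ x)%G \in C by rewrite -stC; apply: imset_f.
  case/orP: (chain_total chC CQ CQx) => //= sQ.
  by have /eqP <- : Q :==: Q :^ x by rewrite eqEcard sQ cardJg leqnn.
case=> Gx nx; split=> //; apply/astab1P/setP=> Q; rewrite in_chain_conj.
apply/idP/idP=> CQ.
  rewrite (_ : Q = (Q :^ x^-1)%G) //; apply: group_inj.
  by have /normP := nx _ CQ; rewrite /= conjsgKV.
rewrite (_ : (_ :^ _)%G = Q) //; apply: group_inj.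
by have := nx _ CQ; rewrite -groupV => /normP.
Qed.

(** The normaliser of [Q] in ['O_p(G)] is a normal [p]-subgroup of ['N_G(Q)], so lies in [Q]. Thus
    [Q] is self-normalising in the [p]-group ['O_p(G) <*> Q], and equals it. *)
Lemma pcore_sub_radical Q :
  radical p G Q -> 'O_p(G) \subset Q.
Proof.
case/and3P=> sQG pQ /eqP radQ.
have nOQ : Q \subset 'N('O_p(G)) := subset_trans sQG (gFnorm _ _).
have pOQ : p.-group ('O_p(G) <*> Q)%G.
  by rewrite /= norm_joinEr // pgroupM pcore_pgroup.
suff /eqP eqOQ : Q :==: 'O_p(G) <*> Q by rewrite eqOQ joing_subl.
rewrite eq_sym; apply/eqP/(nilpotent_sub_norm (pgroup_nil pOQ)) => /=; first exact: joing_subr.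
rewrite norm_joinEr // setIC -group_modr ?normG // mul_subG // setIC {2}radQ.
apply: pcore_max; first exact: pgroupS (subsetIl _ _) (pcore_pgroup _ _).
apply/andP; split; first by rewrite setSI ?pcore_sub.
apply: normsI; last exact: subset_trans (subsetIr _ _) (normG _).
exact: subset_trans (subsetIl _ _) (gFnorm _ _).
Qed.

End ChainConjugation.

(** * Alternating sums over chains *)

Section ChainSums.
Import mathcomp.boot.fintype mathcomp.boot.finset.
Variables (k : fieldType) (U : zmodType) (p : nat) (F : pairs k).
Hypotheses (charkp : p \in [pchar k]) (famF : is_family p F).
Variables f h : pairfun k U.
Hypotheses (freeU : free_abelian U) (isof : iso_constant F f).
Hypothesis f_radical :
  forall (gT : finGroupType) (G : {group gT}) (B : galg k gT), F G B ->
  f G B *+ #|G| = \sum_(Q : {group gT} | radical p G Q && (Q :!=: 1%g))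
                    radical_term p h G B Q *+ #|'N_G(Q)|.
Variables (gT : finGroupType) (G : {group gT}) (B : galg k gT).
Hypothesis FG : F G B.
Implicit Types (C : {set {group gT}}) (K L P Q : {group gT}).

Let idemB : central_idem G B.
Proof. by have [_ []] := famF FG. Qed.

Let chain_sum C : U := \sum_(b \in chain_blocks G B C) f (chain_stab G C) b.

Lemma finite_chain_blocks C : finite_set (chain_blocks G B C).
Proof. by apply: (sub_finite_set _ (finite_blocks k (chain_stab G C))) => b []. Qed.

Lemma in_galg_Br P : in_galg G (Br G P B).
Proof.
by move=> x nGx; rewrite ffunE ifN //; apply: contra nGx => /setIP[].
Qed.

Lemma chain_sum_conj C x :
  is_chain p G C -> x \in G -> chain_sum (('JG^*)%act C x) = chain_sum C.
Proof.
move=> chC Gx; have chCx := is_chain_conj Gx chC.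
have [CT topC] := chain_topP chC; have sTG := chain_sub chC CT.
pose phi := conjgm_morphism G x; have injphi : 'injm phi := injm_conj G x.
have phiG : (phi @* G)%G = G.
  by apply: group_inj; rewrite /= norm_conjg_im // (subsetP (normG G)).
have phiE L : L \subset G -> (L :^ x)%G = (phi @* L)%G.
  by move=> sLG; apply: group_inj; rewrite /= morphim_conj (setIidPr sLG).
have phiB : galg_map phi B = B by apply: conjgm_galg_map.
have sSG := chain_stab_sub chC.
have stabE : chain_stab G (('JG^*)%act C x) = (phi @* chain_stab G C)%G.
  by rewrite (chain_stab_conj Gx chC) phiE.
have topE : chain_top (('JG^*)%act C x) = (phi @* chain_top C)%G.
  by rewrite (chain_top_conj Gx chC) phiE.
have brphi : galg_map phi (Br G (chain_top C) B) = Br G (phi @* chain_top C) B.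
  by rewrite galg_map_Br // phiG phiB.
have XY b : chain_blocks G B C b ->
    chain_blocks G B (('JG^*)%act C x) (galg_map phi b).
  case=> blkb brb; split; first by rewrite stabE; apply: galg_map_block.
  have [[Lb _ _] _ _] := blkb; have Gb := in_galgS sSG Lb.
  by rewrite topE -brphi -(galg_mapM injphi) ?brb //; apply: in_galg_Br.
apply: (fsbig_galg_map (injphi := injphi)) => //.
- by move=> b [[[Lb _ _] _ _] _]; apply: in_galgS Lb.
- move=> b [[[Lb _ _] _ _] _]; apply: in_galgS Lb.
  by rewrite stabE; apply: morphimS.
- move=> b [blkb brb]; rewrite stabE in blkb; rewrite topE in brb.
  have sSG' : phi @* chain_stab G C \subset phi @* G by apply: morphimS.
  have invS : (invm injphi @* (phi @* chain_stab G C))%G = chain_stab G C.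
    exact: morphim_invm_group.
  split; first by rewrite -invS; apply: (galg_map_block (injm_invm injphi)).
  have [[Lb _ _] _ _] := blkb; have Gb := in_galgS sSG' Lb.
  rewrite -(galg_mapK injphi (in_galg_Br (chain_top C))) brphi.
  rewrite -(galg_mapM (injm_invm injphi)) ?brb // phiG; exact: in_galg_Br.
move=> b Cb; have FCb := chain_block_family charkp famF chC FG Cb.
have FCxb := chain_block_family charkp famF chCx FG (XY b Cb).
rewrite stabE in FCxb *; have [[[Lb _ _] _ _] _] := Cb.
exact: (iso_constant_sub injphi isof).
Qed.

(** The contribution of a pair [(C, Q)], with [K] standing for the normaliser of [Q] in the
    stabiliser. [C] enters only through [K], and its top has been replaced by [Q]. *)
Let pair_term K Q : U :=
  (\sum_(b \in [set b | is_block K b /\ Br G Q B * b = b]%classic) h K b) *+ #|K|.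

(** Each [f] is expanded by [f_radical] and the sums are exchanged. For fixed [Q], the top [T] lies
    in [Q], so truncating [Br G T B] at [Q] gives [Br G Q B]. A block of ['N_K(Q)] below the latter
    is induced to some [b] by [ex_block_below], and to only one by [block_induces_inj]. *)
Lemma chain_sum_radical C : is_chain p G C -> normal_chain C ->
  chain_sum C *+ #|chain_stab G C| =
    \sum_(Q : {group gT} | radical p (chain_stab G C) Q && (Q :!=: 1%g))
      pair_term 'N_(chain_stab G C)(Q) Q.
Proof.
move=> chC nC; set K := chain_stab G C.
have [CT topC] := chain_topP chC; set T := chain_top C in CT topC.
have [sTG pT] := (chain_sub chC CT, chain_pgroup chC CT).
have sTK : T \subset K := normal_chain_stab chC nC CT.
have nTK : K \subset 'N(T) := chain_stab_norm chC CT.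
have sKG : K \subset G := chain_stab_sub chC.
have sCK : 'C_G(T) \subset K.
  apply/subsetP=> x /setIP[Gx Cx]; apply/(chain_stabP _ chC); split=> // Q CQ.
  exact: subsetP (subset_trans (centS (topC _ CQ)) (cent_sub Q)) _ Cx.
have sTO : T \subset 'O_p(K) by apply: pcore_max => //; apply/andP.
have idemE : central_idem K (Br G T B) by apply: (Br_central_idem charkp).
have [KE _ _] := idemE.
rewrite /chain_sum fsbig_finite; last exact: finite_chain_blocks.
rewrite -sumrMnl.
transitivity (\sum_(b <- finmap.enum_fset (fset_set (chain_blocks G B C)))
    \sum_(Q : {group gT} | radical p K Q && (Q :!=: 1%g))
      radical_term p h K b Q *+ #|'N_K(Q)|).
  apply: eq_big_seq => b; rewrite in_fset_set; last exact: finite_chain_blocks.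
  by move=> /set_mem Cb; apply/f_radical/(chain_block_family charkp famF chC FG Cb).
rewrite exchange_big /=; apply: eq_bigr => Q /andP[radQ _].
have [sQK pQ _] := and3P radQ.
have sTQ : T \subset Q := subset_trans sTO (pcore_sub_radical radQ).
have sCQ : 'C_G(Q) \subset K by apply: subset_trans (setIS G (centS sTQ)) sCK.
have sN : (Q * 'C_K(Q))%g \subset 'N_K(Q).
  by rewrite mul_subG ?setIS ?cent_sub // subsetI sQK normG.
have brE : Br K Q (Br G T B) = Br G Q B by apply: Br_Br.
have brM e : central_idem K e -> Br K Q (Br G T B * e) = Br G Q B * Br K Q e.
  move=> idem; rewrite (Br_mul charkp pQ) ?brE // => x y /(subsetP sQK).
    exact: central_conj idemE.
  exact: central_conj idem.
rewrite sumrMnl /pair_term; congr (_ *+ _).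
rewrite -fsbig_finite; last exact: finite_chain_blocks.
apply: fsbig_fibers; first exact: finite_chain_blocks.
- by apply: (sub_finite_set _ (finite_blocks k 'N_K(Q)%G)) => b [].
- move=> b c [[idemb _ _] brb] indc; have [_ blkc _] := indc; split=> //.
  have brc : Br K Q b * c = c by apply: (block_induces_at charkp pQ sN _ indc).
  have {}brb : Br K Q b = Br G Q B * Br K Q b.
    by rewrite -(brM b idemb) [Br G T B * b]brb.
  by rewrite -{1}brc mulrA -brb brc.
- move=> c [blkc brc].
  have [||b [blkb eb brb]] := ex_block_below charkp pQ sN (subxx _) blkc (e := Br G T B) => //.
    by rewrite brE.
  by exists b => //; split=> //; exists Q.
move=> b1 b2 c; exact: (block_induces_inj charkp).
Qed.

Lemma normal_chains_sum0 :
  \sum_(C | is_chain p G C && normal_chain C)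
     (chain_sum C *+ #|chain_stab G C|) *~ (-1) ^+ chain_len C = 0.
Proof.
(* The condition [CQ.2 != 1%G] ensures that toggling never removes the trivial subgroup from the
   chain. *)
pose admissible (CQ : {set {group gT}} * {group gT}) :=
  [&& is_chain p G CQ.1, normal_chain CQ.1, radical p (chain_stab G CQ.1) CQ.2
    & CQ.2 != 1%G].
transitivity (\sum_(CQ | admissible CQ)
    pair_term 'N_(chain_stab G CQ.1)(CQ.2) CQ.2 *~ (-1) ^+ chain_len CQ.1).
  rewrite (eq_bigr (fun C => \sum_(Q | radical p (chain_stab G C) Q && (Q != 1%G))
      pair_term 'N_(chain_stab G C)(Q) Q *~ (-1) ^+ chain_len C)).
    by rewrite pair_big_dep; apply: eq_bigl => CQ; rewrite /admissible -!andbA.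
  by move=> C /andP[chC nC]; rewrite chain_sum_radical // mulrz_suml.
have toggled C Q : admissible (C, Q) ->
    admissible (toggle Q C, Q) /\
    'N_(chain_stab G (toggle Q C))(Q)%G = 'N_(chain_stab G C)(Q)%G.
  case/and4P=> /= chC nC radQ ntQ; set K := chain_stab G C.
  have [CT topC] := chain_topP chC; have [sQK pQ /eqP defQ] := and3P radQ.
  have sKG := chain_stab_sub chC.
  have sTQ P : P \in C -> P \subset Q.
    move=> CP; apply: subset_trans (pcore_sub_radical radQ).
    apply: subset_trans (topC P CP) _; apply: pcore_max.
      exact: chain_pgroup chC CT.
    by rewrite /normal (normal_chain_stab chC nC CT) (chain_stab_norm chC CT).
  have chC' : is_chain p G (toggle Q C).
    apply: is_chain_toggle => //; first exact: subset_trans sKG.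
    by move=> P CP; rewrite (sTQ P CP) orbT.
  have sQK' : Q \subset chain_stab G (toggle Q C).
    apply/subsetP=> x Qx; have Kx := subsetP sQK x Qx.
    apply/(chain_stabP _ chC'); split=> [|P]; first exact: (subsetP sKG).
    rewrite in_toggle; case: eqP => [-> _ | _ CP]; first exact: (subsetP (normG Q)).
    exact: subsetP (chain_stab_norm chC CP) _ Kx.
  (* Among elements normalising [Q], the presence of [Q] in the chain imposes no condition. *)
  have nE : 'N_(chain_stab G (toggle Q C))(Q)%G = 'N_K(Q)%G.
    apply/group_inj/setP=> x; rewrite /= !in_setI.
    have [nQx|_] := boolP (x \in 'N(Q)); last by rewrite !andbF.
    rewrite !andbT; apply/(chain_stabP _ chC')/(chain_stabP _ chC) => -[Gx nx].
      split=> // P CP.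
      by have [->//|nPQ] := eqVneq P Q; apply: nx; rewrite in_toggle (negPf nPQ).
    split=> // P; rewrite in_toggle; case: eqP => [-> // | _]; exact: nx.
  split=> //; apply/and4P; split=> //=.
    apply: (normal_chainP chC') => P; rewrite in_toggle; case: eqP => [-> // | _ CP].
    exact: subset_trans (sTQ P CP) sQK'.
  (* Beyond the inclusion [sQK'], radicality involves the stabiliser only through the normaliser of
     [Q] in it, which is unchanged. *)
  apply/and3P; split=> //; rewrite {1}defQ.
  by rewrite -[X in _ == 'O_p(X)]/(gval 'N_(chain_stab G (toggle Q C))(Q)%G) nE.
apply: (involution_sum0 (s := fun CQ => (toggle CQ.2 CQ.1, CQ.2))) => //.
- by case=> C Q /toggled[].
- by case=> C Q _; rewrite /= toggleK.
case=> C Q admCQ; have [_ /= ->] := toggled C Q admCQ.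
have /and4P[/= /and3P[C1 _ _] _ _ ntQ] := admCQ.
by rewrite /chain_len (toggle_sign _ C1) ?mulrNz // eq_sym.
Qed.

Lemma chain_local (R : {set {set {group gT}}}) : chain_reps p G R ->
  \sum_(C in R) chain_sum C *~ (-1) ^+ chain_len C = 0.
Proof.
move=> repR; apply: (free_abelian_torsion_free freeU (cardG_gt0 G)).
rewrite (sum_transversal (acts_chains p G) repR) => [|C x]; last first.
  by rewrite inE => chC Gx; rewrite chain_sum_conj // chain_len_conj.
transitivity (\sum_(C | is_chain p G C)
    (chain_sum C *+ #|chain_stab G C|) *~ (-1) ^+ chain_len C).
  apply: eq_big => [C | C]; rewrite inE // => chC.
  by rewrite (card_chain_stab chC) // !pmulrn mulrzAC.
rewrite (bigID (@normal_chain gT)) /= normal_chains_sum0 add0r.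
(* The weighted [chain_sum C] depends on [C] only through its stabiliser and its top, as
   [nonnormal_chains_sum0] requires. *)
pose phi K T : U :=
  (\sum_(b \in [set b | is_block K b /\ Br G T B * b = b]%classic) f K b) *+ #|K|.
exact: (nonnormal_chains_sum0 p G phi freeU).
Qed.

End ChainSums.

Theorem theorem3p10 (p : nat) (k : closedFieldType) (kp : p \in [pchar k])
    (U : zmodType) (freeU : free_abelian U)
    (F : pairs k) (famF : is_family p F)
    (f h : pairfun k U) (h_iso : iso_constant F h)
    (f_eq : forall (gT : finGroupType) (G : {group gT}) (B : galg k gT),
       F gT G B ->
       exists2 T : {set {group gT}}, radical_reps p G T &
         f gT G B =
           \sum_(Q in T | Q :!=: 1%g)
             \sum_(b \in [set b | block_induces p G B 'N_G(Q)%G b]%classic)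
               h gT 'N_G(Q)%G b) :
  block_chain_local p F f.
Proof.
have isof := f_iso famF freeU h_iso f_eq; split=> // gT G B FG R repR.
exact: (chain_local kp famF freeU isof (radical_sum famF h_iso f_eq) FG repR).
Qed.
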